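(* Let $\mathrm{CF}(l_1,l_2,l_3,l_4)$ be an algebraic $3$-dimensional continued fraction, and let $l_1$ be spanned by the vector $(1,\alpha,\beta,\gamma)$. Then $\mathrm{CF}(l_1,l_2,l_3,l_4)$ has a proper cyclic symmetry if and only if there exists an algebraic number $\omega$ of degree $4$, with its conjugates $\omega',\omega'',\omega'''$, such that at least one of the following holds: (1) $(1,\alpha,\beta,\gamma)\sim(1,\omega,\omega',\omega'')$ and $\mathrm{Tr}(\omega)=\omega+\omega'+\omega''+\omega'''=0$; (2) $(1,\alpha,\beta,\gamma)\sim(1,\omega,\omega',\omega'')$ and $\mathrm{Tr}(\omega)=1$; (3) $(1,\alpha,\beta,\gamma)\sim(1,\omega,\omega',\omega'')$ and $\mathrm{Tr}(\omega)=2$; (4) $(1,\alpha,\beta,\gamma)\sim(1,\omega,\omega',\tfrac{\omega+\omega''}{2})$ and $\mathrm{Tr}(\omega)=0$; (5) $(1,\alpha,\beta,\gamma)\sim(1,\omega,\omega',\tfrac{\omega+\omega''}{2})$ and $\mathrm{Tr}(\omega)=2$; (6) $(1,\alpha,\beta,\gamma)\sim(1,\omega,\omega',\tfrac{\omega+\omega''+1}{2})$ and $\mathrm{Tr}(\omega)=0$; (7) $(1,\alpha,\beta,\gamma)\sim(1,\omega,\omega',\tfrac{\omega+\omega''+1}{2})$ and $\mathrm{Tr}(\omega)=2$. Moreover, if one of (1)–(7) holds, then the degree-$4$ extension $\mathbb{Q}(\alpha,\beta,\gamma)/\mathbb{Q}$ is normal.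
   Context: For one-dimensional subspaces $l_1,\dots,l_4$ of $\mathbb{R}^4$ spanning $\mathbb{R}^4$, the hyperplanes spanned by triples of them divide $\mathbb{R}^4$ into $16$ simplicial cones with apex $\vec 0$; such a cone is irrational if the span of each facet contains no integer point except $\vec 0$. For an irrational cone $C$, $\mathcal{K}(C)=\operatorname{conv}(C\cap\mathbb{Z}^4\setminus\{\vec 0\})$ and its boundary is a sail; $\mathrm{CF}(l_1,\dots,l_4)$ is the union of all $16$ sails. $A\in\mathrm{GL}_4(\mathbb{Z})$ is hyperbolic if its eigenvalues are real and its characteristic polynomial is irreducible over $\mathbb{Q}$; if $l_1,\dots,l_4$ are the eigenspaces of such $A$, $\mathrm{CF}(l_1,\dots,l_4)$ is an algebraic $3$-dimensional continued fraction. (Then $1,\alpha,\beta,\gamma$ form a basis of a totally real field $K=\mathbb{Q}(\alpha,\beta,\gamma)$ of degree $4$.) A symmetry is $G\in\mathrm{GL}_4(\mathbb{Z})$ with $G(\mathrm{CF})=\mathrm{CF}$, equivalently $G(l_i)=l_{\sigma_G(i)}$ for a permutation $\sigma_G$; it is cyclic if $\sigma_G$ is a $4$-cycle, and a cyclic (hence palindromic, i.e. $\sigma_G\ne\mathrm{id}$) symmetry is proper if $G$ has a fixed point on some sail. $\mathrm{Tr}(\omega)$ denotes the trace $\mathrm{Tr}_{\mathbb{Q}(\omega)/\mathbb{Q}}(\omega)$. For $\vec v_1,\vec v_2\in\mathbb{R}^4$, $\vec v_1\sim\vec v_2$ means there exist $X\in\mathrm{GL}_4(\mathbb{Z})$ and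 a real $\mu\neq0$ with $X\vec v_1=\mu\vec v_2$.
   Formalization: In the equivalence the conjugates are labelled in cyclic order: a field automorphism sends ω→ω′→ω″→ω‴→ω. With arbitrary labelling the ''if'' part fails, e.g. ω=√2+√3+√6 (Klein four Galois group). The normality part keeps arbitrary labelling. *)

(* Defs.v *)
From HB Require Import structures.
From mathcomp Require Import all_boot all_order all_algebra all_fingroup.
From mathcomp Require Import classical_sets reals topology normedtype convex.
Set Implicit Arguments.
Unset Strict Implicit.
Unset Printing Implicit Defensive.
Import Order.TTheory GRing.Theory Num.Theory.
Import numFieldNormedType.Exports.
Local Open Scope classical_set_scope.
Local Open Scope ring_scope.

Section ContinuedFraction.
Variable R : realType.
Implicit Types (u : 'I_4 -> 'cV[R]_4) (l : 'I_4 -> {vspace 'cV[R]_4}).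
Implicit Types (A G : 'M[int]_4) (a : 'I_4 -> R) (C : set 'cV[R]_4).

Definition toR m n (M : 'M[int]_(m, n)) : 'M[R]_(m, n) := map_mx intr M.

Definition integer_points : set 'cV[R]_4 := range (@toR 4 1).

Definition cone u : set 'cV[R]_4 :=
  [set x | exists2 t : 'I_4 -> R,
     forall i, 0 <= t i & x = \sum_i t i *: u i].

(* The facets of [cone u] are spanned by three of the four vectors [u i]. *)
Definition irrational_cone u : Prop :=
  forall (j : 'I_4) (z : 'cV[R]_4), integer_points z ->
    z \in (\sum_(i < 4 | i != j) <[u i]>)%VS -> z = 0.

Definition conv_hull (X : set 'cV[R]_4) : set 'cV[R]_4 :=
  smallest (fun Y : set 'cV[R]_4 => convex_set Y) X.

Definition klein_polyhedron C : set 'cV[R]_4 :=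
  conv_hull ((C `&` integer_points) `\ 0).

Definition boundary (X : set 'cV[R]_4) : set 'cV[R]_4 :=
  closure X `\` interior X.

(* Choosing a nonzero vector [u i] on each line [l i] selects one of its two
   rays; the sixteen choices of rays give the sixteen simplicial cones cut out
   by the hyperplanes spanned by triples of the lines. *)
Definition sails l : set (set 'cV[R]_4) :=
  [set S | exists u, [/\ forall i, (u i \in l i) && (u i != 0),
     irrational_cone u & S = boundary (klein_polyhedron (cone u))]].

Definition CF l : set 'cV[R]_4 := \bigcup_(S in sails l) S.

(* [a] lists the roots of the characteristic polynomial, with multiplicity; its
   existence says that all the complex eigenvalues of [A] are real. *)
Definition eigenvalues A a : Prop :=
  char_poly (toR A) = \prod_(i < 4) ('X - (a i)%:P).

Definition hyperbolic A : Prop :=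
  [/\ A \in unitmx, exists a, eigenvalues A a &
      irreducible_poly (char_poly (map_mx intr A : 'M[rat]_4))].

Definition algebraic_CF l : Prop :=
  exists A a, [/\ hyperbolic A, eigenvalues A a &
    forall i, l i = passmx.leigenspace (linfun (mulmx (toR A))) (a i)].

Definition CF_symmetry l G : Prop :=
  G \in unitmx /\ [set toR G *m x | x in CF l] = CF l.

Definition permutes_lines l G (s : 'S_4) : Prop :=
  forall i, (linfun (mulmx (toR G)) @: l i)%VS = l (s i).

Definition cyclic_symmetry l G : Prop :=
  CF_symmetry l G /\
  exists2 s : 'S_4, permutes_lines l G s & porbit s ord0 = [set: 'I_4]%SET.

Definition has_fixed_point_on_sail l G : Prop :=
  exists2 S, sails l S & exists2 x, S x & toR G *m x = x.

Definition proper_cyclic_symmetry l G : Prop :=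
  cyclic_symmetry l G /\ has_fixed_point_on_sail l G.

Definition vec4 (x y z t : R) : 'cV[R]_4 :=
  \col_(i < 4) nth 0 [:: x; y; z; t] i.

Definition sim (v w : 'cV[R]_4) : Prop :=
  exists X : 'M[int]_4, exists mu : R,
    [/\ X \in unitmx, mu != 0 & toR X *m v = mu *: w].

(* [w] is algebraic of degree 4 over the rationals, with minimal polynomial [p]
   and conjugates [w1], [w2], [w3].  They are taken in [R] because [sim] relates
   real vectors: in each of the seven cases below it makes [w], [w1] and [w2]
   real, hence [w3] as well since the trace is rational. *)
Definition conjugates4 (w w1 w2 w3 : R) : Prop :=
  exists2 p : {poly rat}, irreducible_poly p &
    map_poly ratr p =
      ('X - w%:P) * ('X - w1%:P) * ('X - w2%:P) * ('X - w3%:P).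

(* The smallest subfield of [R] containing [s]. *)
Definition Qadjoin (s : seq R) : set R :=
  [set x | forall F : {pred R},
     GRing.divring_closed F -> {subset s <= F} -> x \in F].

(* [w], [w1], [w2], [w3] are labelled in the cyclic order in which a field
   automorphism [s] of [Q(w, w1, w2, w3)] permutes them: [w1 = s w],
   [w2 = s w1] and [w3 = s w2].  For an arbitrary labelling, having one of
   the seven cases does not imply that a cyclic symmetry exists: the biquadratic
   number [w = sqrt 2 + sqrt 3 + sqrt 6] has trace 0 and
   [1, w, w1, w2] is a basis of [Q(sqrt 2, sqrt 3)], but over a field
   whose Galois group is the Klein group no symmetry acts as a 4-cycle. *)
Definition cyclically_ordered (w w1 w2 w3 : R) : Prop :=
  let K := Qadjoin [:: w; w1; w2; w3] in
  exists s : R -> R,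
    [/\ forall x, K x -> K (s x), s 1 = 1,
        forall x y, K x -> K y -> s (x + y) = s x + s y,
        forall x y, K x -> K y -> s (x * y) = s x * s y &
        [/\ s w = w1, s w1 = w2, s w2 = w3 & s w3 = w]].

Definition seven_cases (v : 'cV[R]_4) (w w1 w2 w3 : R) : Prop :=
  let Tr := w + w1 + w2 + w3 in
  (sim v (vec4 1 w w1 w2) /\ Tr = 0) \/
  (sim v (vec4 1 w w1 w2) /\ Tr = 1) \/
  (sim v (vec4 1 w w1 w2) /\ Tr = 2) \/
  (sim v (vec4 1 w w1 ((w + w2) / 2)) /\ Tr = 0) \/
  (sim v (vec4 1 w w1 ((w + w2) / 2)) /\ Tr = 2) \/
  (sim v (vec4 1 w w1 ((w + w2 + 1) / 2)) /\ Tr = 0) \/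
  (sim v (vec4 1 w w1 ((w + w2 + 1) / 2)) /\ Tr = 2).

Definition degree_over_Q (K : set R) (n : nat) : Prop :=
  exists2 b : 'I_n -> R, forall i, K (b i) &
    forall x, K x -> exists! c : 'rV[rat]_n, x = \sum_i ratr (c 0 i) * b i.

Definition normal_over_Q (K : set R) : Prop :=
  (forall x, K x -> algebraicOver (ratr : rat -> R) x) /\
  forall p : {poly rat}, irreducible_poly p ->
    (exists2 x, K x & root (map_poly ratr p) x) ->
    exists2 s : seq R, {in s, forall y, K y} &
      map_poly ratr p %= \prod_(y <- s) ('X - y%:P).

End ContinuedFraction.

(* Main.v *)
(* A cyclic symmetry [G] permutes the four eigenlines [l i] in a cycle.  A point
   of a sail is nonzero, so a fixed point on a sail forces [G^4 v = v] for [v] on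
   [l ord0]: [v, G v, G^2 v, G^3 v] is a basis permuted cyclically by [G],
   whence [tr G = tr G^2 = 0] and [1], [-1] are eigenvalues of [G].  Splitting off
   primitive integer eigenvectors for [1] and [-1] leaves a 2x2 integer block of
   square [-1], which is reduced like a binary quadratic form of discriminant
   [-4]; the remaining parameters matter modulo 2 or 4 only, and [G] is conjugate
   over the integers to one of seven matrices, one for each of the seven cases.
   In the new coordinates the vector spanning [l ord0], normalised to have first
   entry 1, reads (1, w, w', ...), because its entries are polynomials over [rat]
   in an eigenvalue of the matrix [A] defining the lines, and [G] acts on them as
   the isomorphism sending this eigenvalue to the next one.

   Conversely, the matrix of a case maps each of the conjugate vectors to the next
   one.  Their sum [y] is an integer point, and the ray through [y], which is fixed
   by the symmetry, leaves the Klein polyhedron at a point of the sail.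

   For normality, all conjugates of [w] lie in the field, and the characteristic
   polynomial of [g (B)], where the rational matrix [B] has eigenvalues
   [w, w', ...], is the product of the [X - g (w^(i))], so that every [g (w)] has
   all its conjugates in the field. *)
Require Import Defs.
From HB Require Import structures.
From mathcomp Require Import all_boot all_order all_algebra all_fingroup.
From mathcomp Require Import classical_sets reals topology normedtype convex.
From mathcomp Require Import boolp interval_inference ring zify separable.
Import Order.TTheory GRing.Theory Num.Theory.
Import numFieldNormedType.Exports.
Local Open Scope ring_scope.
Set Implicit Arguments.
Unset Strict Implicit.
Unset Printing Implicit Defensive.

(** * Irreducible rational polynomials and eigenvectors *)

Lemma irreducible_poly_neq0 (F : fieldType) (p : {poly F}) :
  irreducible_poly p -> p != 0.
Proof. by case=> p1 _; rewrite -size_poly_gt0 (leq_trans _ p1). Qed.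

(** A Bezout relation between the characteristic polynomial and [p], evaluated at [B], gives an
    inverse of [p(B)] by Cayley-Hamilton. *)
Lemma horner_mx_irreducible_unit (F : fieldType) n (B : 'M[F]_n.+1)
    (p : {poly F}) :
  irreducible_poly (char_poly B) -> ~~ (char_poly B %| p) ->
  horner_mx B p \in unitmx.
Proof.
move=> irrB ndvd.
have /Bezout_eq1_coprimepP[[u w] /= uw] : coprimep (char_poly B) p.
  by rewrite irreducible_poly_coprime.
have := congr1 (horner_mx B) uw.
rewrite rmorphD !rmorphM /= Cayley_Hamilton mulr0 add0r rmorph1 => /mulmx1_unit.
by case.
Qed.

(** A linear relation between the rows [r B^i] reads [r h(B) = 0] with [h] of degree below that of
    the characteristic polynomial; if [h != 0] then [h(B)] is invertible, which would give
    [r = 0]. *)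
Lemma krylov_unitmx (F : fieldType) n (B : 'M[F]_n.+1) (r : 'rV[F]_n.+1) :
  irreducible_poly (char_poly B) -> r != 0 ->
  (\matrix_(i < n.+1) (r *m B ^+ i)) \in unitmx.
Proof.
move=> irrB r0; rewrite -row_free_unit; apply: inj_row_free => v.
have -> : v *m (\matrix_(i < n.+1) (r *m B ^+ i)) = r *m horner_mx B (rVpoly v).
  rewrite horner_rVpoly /= mulmx_sum_row.
  rewrite (mulmx_sum_row v (powers_mx B n.+1)) linear_sum /= mulmx_sumr.
  by apply: eq_bigr => i _; rewrite !rowK linearZ /= mxvecK -scalemxAr.
move=> rv0; apply/eqP/contraT => v0.
have v0' : rVpoly v != 0.
  by apply: contra_neq v0 => vp0; rewrite -[v]rVpolyK vp0 linear0.
have : horner_mx B (rVpoly v) \in unitmx.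
  apply: horner_mx_irreducible_unit => //; apply/negP => /(dvdp_leq v0').
  by rewrite size_char_poly leqNgt ltnS size_poly.
by move=> u; have := mulmxK u r; rewrite rv0 mul0mx => /esym/eqP; rewrite (negPf r0).
Qed.

Section RationalIrreducible.
Variable R : numFieldType.
Implicit Types (p q h : {poly rat}) (a : R).
Local Notation "p ^R" := (map_poly (ratr : rat -> R) p) (at level 2, format "p ^R").

Lemma irreducible_dvdp_root p a h :
  irreducible_poly p -> root p^R a -> (p %| h) = root h^R a.
Proof.
move=> irr pa; apply/idP/idP => [/dvdpP[q ->]|ha].
  by rewrite rmorphM rootM pa orbT.
apply/contraT; rewrite -(irreducible_poly_coprime h irr).
rewrite -(coprimep_map (ratr : {rmorphism rat -> R})) => /coprimep_root/(_ pa).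
by rewrite -[_.[a] == 0]/(root _ a) ha.
Qed.

Lemma irreducible_roots_uniq p (I : eqType) (s : seq I) (a : I -> R) :
  irreducible_poly p -> p^R = \prod_(i <- s) ('X - (a i)%:P) ->
  uniq [seq a i | i <- s].
Proof.
move=> irr pE; rewrite -separable_prod_XsubC big_map -pE separable_map.
rewrite unlock irreducible_poly_coprime //; apply/negP => pd.
have p0 := irreducible_poly_neq0 irr.
(* In characteristic 0 the top coefficient of the derivative is a nonzero multiple of the leading
   coefficient of [p]. *)
have d0 : p^`() != 0.
  case: (irr) => p1 _; apply/eqP => /(congr1 (fun q : {poly rat} => q`_(size p).-2)).
  rewrite coef_deriv coef0 => /eqP; rewrite mulrn_eq0 /=.
  have -> : (size p).-2.+1 = (size p).-1 by case: (size p) p1 => [|[]].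
  by rewrite -lead_coefE lead_coef_eq0 (negPf p0).
by have := dvdp_leq d0 pd; rewrite leqNgt lt_size_deriv.
Qed.

(* When [a] and [b] are roots of the same irreducible rational polynomial, this is
   the field isomorphism from [Q(a)] to [Q(b)] sending [a] to [b].  Its value
   outside of [Q(a)] is the junk [0]. *)
Definition conj_map a b (x : R) : R :=
  match pselect (exists h : {poly rat}, x = h^R.[a]) with
  | left hx => (projT1 (cid hx))^R.[b]
  | right _ => 0
  end.

(** Independence of the chosen polynomial: two polynomials with the same value at [a] differ by a
    multiple of [p], hence agree at [b] too. *)
Lemma conj_mapE p a b h : irreducible_poly p -> root p^R a -> root p^R b ->
  conj_map a b h^R.[a] = h^R.[b].
Proof.
move=> irr pa pb; rewrite /conj_map; case: pselect => [hx|[]]; last by exists h.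
case: cid => /= g /eqP; rewrite -subr_eq0 -hornerN -hornerD => hg.
have : p %| (h - g) by rewrite (irreducible_dvdp_root _ irr pa) rmorphB.
rewrite (irreducible_dvdp_root _ irr pb) rmorphB /root hornerD hornerN subr_eq0.
by move/eqP.
Qed.

Lemma ratr_horner_inv p a h : irreducible_poly p -> root p^R a ->
  exists g, forall b, root p^R b -> g^R.[b] = h^R.[b]^-1.
Proof.
move=> irr pa; have [pdh|] := boolP (p %| h).
  (* Here [h] vanishes at every root, and the convention [0^-1 = 0] makes the zero polynomial
     fit. *)
  exists 0 => b pb; move: pdh; rewrite (irreducible_dvdp_root _ irr pb).
  by move=> /eqP ->; rewrite invr0 rmorph0 horner0.
move=> ndvd; have /Bezout_eq1_coprimepP[[u w] /= uw] : coprimep p h.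
  by rewrite irreducible_poly_coprime.
exists w => b pb; have := congr1 (fun g : {poly rat} => g^R.[b]) uw.
rewrite rmorphD !rmorphM rmorph1 hornerD !hornerM (eqP pb) mulr0 add0r hornerC.
by move=> wh; apply/divr1_eq; rewrite invrK.
Qed.

End RationalIrreducible.

(** * Eigenvectors and characteristic polynomials over a field *)

Section Eigen.
Variable F : fieldType.

Lemma horner_mx_eigen n (B : 'M[F]_n.+1) (v : 'cV_n.+1) (a : F) (h : {poly F}) :
  B *m v = a *: v -> horner_mx B h *m v = h.[a] *: v.
Proof.
move=> Bv; elim/poly_ind: h => [|h c IH].
  by rewrite rmorph0 mul0mx horner0 scale0r.
rewrite rmorphD rmorphM /= horner_mx_X horner_mx_C hornerMXaddC mulmxDl.
by rewrite -mulmxA Bv -scalemxAr IH mul_scalar_mx scalerA -scalerDl mulrC.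
Qed.

Lemma mulmx_sum_col m n (P : 'M[F]_(m, n)) (v : 'cV_n) :
  P *m v = \sum_i v i 0 *: col i P.
Proof.
apply/colP => i; rewrite mxE summxE; apply: eq_bigr => j _.
by rewrite !mxE mulrC.
Qed.

Lemma eigenvectors_unitmx n (B : 'M[F]_n.+1) (P : 'M[F]_n.+1) (a : 'I_n.+1 -> F) :
  injective a -> (forall j, B *m col j P = a j *: col j P) ->
  (forall j, col j P != 0) -> P \in unitmx.
Proof.
move=> inja BP P0; rewrite -unitmx_tr -row_free_unit; apply: inj_row_free => v vP.
apply/rowP => j; rewrite mxE.
(* [q(B)] kills every eigenvector but the [j]-th, on which it acts by a nonzero scalar because the
   eigenvalues are distinct. *)
pose q := \prod_(i < n.+1 | i != j) ('X - (a i)%:P).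
have : horner_mx B q *m (P *m v^T) = 0.
  by rewrite -[P *m _]trmxK trmx_mul trmxK vP trmx0 mulmx0.
rewrite mulmx_sum_col mulmx_sumr (bigD1 j) //= big1 => [|i ij]; last first.
  rewrite -scalemxAr (horner_mx_eigen _ (BP i)) /q (bigD1 i) //= hornerM.
  by rewrite hornerXsubC subrr mul0r scale0r scaler0.
rewrite addr0 -scalemxAr (horner_mx_eigen _ (BP j)) scalerA mxE => /eqP.
rewrite scaler_eq0 (negPf (P0 j)) orbF mulf_eq0 => /orP[/eqP //|].
rewrite horner_prod => /prodf_eq0[i ij]; rewrite hornerXsubC subr_eq0.
by move/eqP/inja => ji; rewrite ji eqxx in ij.
Qed.

Lemma char_poly_similar n (B P D : 'M[F]_n) :
  P \in unitmx -> B *m P = P *m D -> char_poly B = char_poly D.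
Proof.
move=> Pu BP.
have : char_poly_mx B *m map_mx polyC P = map_mx polyC P *m char_poly_mx D.
  rewrite /char_poly_mx mulmxBl mulmxBr mul_scalar_mx mul_mx_scalar.
  by rewrite -!map_mxM BP.
move/(congr1 determinant); rewrite !det_mulmx [RHS]mulrC => /mulIf; apply.
by rewrite det_map_mx polyC_eq0 -unitfE.
Qed.

Lemma char_poly_eigenbasis n (B P : 'M[F]_n.+1) (a : 'I_n.+1 -> F) :
  P \in unitmx -> (forall j, B *m col j P = a j *: col j P) ->
  char_poly B = \prod_j ('X - (a j)%:P).
Proof.
move=> Pu BP; pose d : 'rV[F]_n.+1 := \row_j a j.
have BPd : B *m P = P *m diag_mx d.
  apply/matrixP => i j; have := congr1 (fun M : 'cV_n.+1 => M i 0) (BP j).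
  rewrite !mxE (eq_bigr (fun k => B i k * P k j)) => [->|k _]; last by rewrite mxE.
  rewrite (bigD1 j) //= big1 => [|k kj].
    by rewrite !mxE eqxx mulr1n addr0 mulrC.
  by rewrite !mxE (negPf kj) mulr0n mulr0.
rewrite (char_poly_similar Pu BPd) char_poly_trig ?diag_mx_is_trig //.
by apply: eq_bigr => i _; rewrite !mxE eqxx mulr1n.
Qed.

Lemma eigen_char_poly_root n (B : 'M[F]_n.+1) (v : 'cV_n.+1) a :
  v != 0 -> B *m v = a *: v -> root (char_poly B) a.
Proof.
move=> v0 Bv; apply/contraT => na.
have := horner_mx_eigen (char_poly B) Bv.
rewrite Cayley_Hamilton mul0mx => /esym/eqP.
by rewrite scaler_eq0 (negPf v0) orbF -[_ == 0]/(root _ _) (negPf na).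
Qed.

Lemma char_poly_tr n (B : 'M[F]_n) : char_poly B^T = char_poly B.
Proof.
rewrite /char_poly -[RHS]det_tr; congr (\det _).
by rewrite /char_poly_mx linearB /= tr_scalar_mx map_trmx.
Qed.

Lemma root_char_poly_eigen n (B : 'M[F]_n.+1) a :
  root (char_poly B) a -> exists2 v : 'cV_n.+1, v != 0 & B *m v = a *: v.
Proof.
rewrite -char_poly_tr -eigenvalue_root_char => /eigenvalueP[v vB v0].
exists v^T; last by rewrite -[B]trmxK -trmx_mul vB linearZ.
by apply: contra_neq v0 => /(congr1 trmx); rewrite trmxK trmx0.
Qed.

End Eigen.

(** * The field spanned by the entries of an eigenvector *)

Section EigenField.
Variable R : realType.
Local Notation "p ^R" := (map_poly (ratr : rat -> R) p) (at level 2, format "p ^R").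
Local Notation ratmx := (map_mx (ratr : rat -> R)).

Definition rowval n (r : 'rV[rat]_n) (v : 'cV[R]_n) : R := (ratmx r *m v) 0 0.

Definition Qspan n (v : 'cV[R]_n) : set R := [set x | exists r, x = rowval r v]%classic.

(** The first entry 1 makes the rational span of the entries contain 1; when the characteristic
    polynomial is irreducible, this span is then the field [Q(a)]. *)
Definition eigenvector1 n (B : 'M[rat]_n.+1) (a : R) (v : 'cV[R]_n.+1) :=
  ratmx B *m v = a *: v /\ v 0 0 = 1.

Lemma rowval_mul n (r : 'rV[rat]_n.+1) (B : 'M[rat]_n.+1) a (v : 'cV[R]_n.+1) :
  ratmx B *m v = a *: v -> rowval (r *m B) v = a * rowval r v.
Proof. by move=> Bv; rewrite /rowval map_mxM -mulmxA Bv -scalemxAr mxE. Qed.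

Lemma ratmx_horner n (B : 'M[rat]_n.+1) h :
  ratmx (horner_mx B h) = horner_mx (ratmx B) h^R.
Proof. exact: map_horner_mx. Qed.

Lemma ratmx_horner_eigen n (B : 'M[rat]_n.+1) h a (v : 'cV[R]_n.+1) :
  ratmx B *m v = a *: v -> ratmx (horner_mx B h) *m v = h^R.[a] *: v.
Proof. by move=> Bv; rewrite ratmx_horner (horner_mx_eigen _ Bv). Qed.

Lemma eigenvector1_neq0 n (B : 'M[rat]_n.+1) a (v : 'cV[R]_n.+1) :
  eigenvector1 B a v -> v != 0.
Proof.
case=> _ v1; apply/eqP => v0; move: v1; rewrite v0 mxE => /eqP.
by rewrite eq_sym oner_eq0.
Qed.

Lemma eigen_root n (B : 'M[rat]_n.+1) a (v : 'cV[R]_n.+1) :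
  v != 0 -> ratmx B *m v = a *: v -> root (char_poly B)^R a.
Proof. by rewrite map_char_poly; apply: eigen_char_poly_root. Qed.

Section Irreducible.
Variables (n : nat) (B : 'M[rat]_n.+1).
Hypothesis irrB : irreducible_poly (char_poly B).

(** If [r v = 0] then [r B^i v = a^i r v = 0] for all [i]; for [r != 0] these rows form an
    invertible Krylov matrix, whence [v = 0]. So the entries of an eigenvector are independent over
    the rationals. *)
Lemma rowval_eq0 r a (v : 'cV[R]_n.+1) :
  v != 0 -> ratmx B *m v = a *: v -> rowval r v = 0 -> r = 0.
Proof.
move=> v0 Bv rv; apply/eqP/contraT => /(krylov_unitmx irrB) Ku.
have : ratmx (\matrix_(i < n.+1) (r *m B ^+ i)) *m v = 0.
  apply/matrixP => i j; rewrite ord1 mxE [RHS]mxE.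
  transitivity (rowval (r *m B ^+ i) v).
    by rewrite /rowval mxE; apply: eq_bigr => k _; rewrite !mxE.
  have -> : B ^+ i = horner_mx B 'X^i by rewrite rmorphXn /= horner_mx_X.
  have Hv := ratmx_horner_eigen 'X^i Bv.
  by rewrite (rowval_mul _ Hv) rv mulr0.
move/(congr1 (mulmx (invmx (ratmx (\matrix_(i < n.+1) (r *m B ^+ i)))))).
by rewrite mulmx0 mulKmx ?map_unitmx // => /eqP; rewrite (negPf v0).
Qed.

(* [h] does not depend on [v], hence is common to all the conjugates of [v]. *)
Lemma rowval_horner r : exists h, forall a v, eigenvector1 B a v ->
  rowval r v = h^R.[a].
Proof.
pose e : 'rV[rat]_n.+1 := delta_mx 0 0.
have e0 : e != 0.
  by apply/eqP => /rowP/(_ 0); rewrite !mxE eqxx => /eqP; rewrite oner_eq0.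
have Ku := krylov_unitmx irrB e0.
set K := \matrix_(i < n.+1) _ in Ku.
set h := rVpoly (r *m invmx K); exists h => a v [Bv v1].
(* The rows [e B^i] form a basis, so [r = e h(B)] for some [h]; applied to [v] this gives [h(a)],
   because [e v = 1]. *)
have rE : r = e *m horner_mx B h.
  rewrite horner_rVpoly /= (mulmx_sum_row _ (powers_mx B n.+1)) linear_sum /=.
  rewrite mulmx_sumr -{1}(mulmxKV Ku r) mulmx_sum_row; apply: eq_bigr => i _.
  by rewrite !rowK linearZ /= mxvecK -scalemxAr.
have e1 : rowval e v = 1 by rewrite /rowval map_delta_mx -rowE mxE v1.
by rewrite [in LHS]rE (rowval_mul _ (ratmx_horner_eigen _ Bv)) e1 mulr1.
Qed.

Lemma horner_rowval h : exists r, forall a v, eigenvector1 B a v ->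
  h^R.[a] = rowval r v.
Proof.
exists (row 0 (horner_mx B h)) => a v [Bv v1].
rewrite /rowval map_row -row_mul (ratmx_horner_eigen _ Bv) !mxE v1 mulr1 //.
Qed.

Variables (a : R) (v : 'cV[R]_n.+1).
Hypothesis eig : eigenvector1 B a v.

Lemma eigenvector1_root : root (char_poly B)^R a.
Proof. exact: eigen_root (eigenvector1_neq0 eig) eig.1. Qed.

Lemma QspanP x : Qspan v x <-> exists h, x = h^R.[a].
Proof.
split=> [[r ->]|[h ->]].
  by have [h /(_ _ _ eig) ->] := rowval_horner r; exists h.
by have [r /(_ _ _ eig) ->] := horner_rowval h; exists r.
Qed.

Lemma Qspan_divring : GRing.divring_closed [pred x | `[< Qspan v x >]].
Proof.
split; first by apply/asboolP/QspanP; exists 1; rewrite rmorph1 hornerC.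
- move=> x y /asboolP/QspanP[h ->] /asboolP/QspanP[g ->].
  by apply/asboolP/QspanP; exists (h - g); rewrite rmorphB hornerD hornerN.
- move=> x y /asboolP/QspanP[h ->] /asboolP/QspanP[g ->].
  have [f fE] := ratr_horner_inv g irrB eigenvector1_root.
  apply/asboolP/QspanP; exists (h * f).
  by rewrite rmorphM hornerM fE // eigenvector1_root.
Qed.

Lemma Qspan_entry i : Qspan v (v i 0).
Proof.
by exists (delta_mx 0 i); rewrite /rowval map_delta_mx -rowE mxE.
Qed.

Lemma Qspan_horner x h : Qspan v x -> Qspan v h^R.[x].
Proof.
move/QspanP=> [g ->]; apply/QspanP; exists (h \Po g).
by rewrite map_comp_poly horner_comp.
Qed.

Lemma Qspan_algebraic x : Qspan v x -> algebraicOver (ratr : rat -> R) x.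
Proof.
move/QspanP=> [h ->]; exists (char_poly (horner_mx B h)).
  by rewrite -size_poly_gt0 size_char_poly.
apply: eigen_root (eigenvector1_neq0 eig) _; apply: ratmx_horner_eigen.
exact: eig.1.
Qed.

Lemma degree_Qspan : degree_over_Q (Qspan v) n.+1.
Proof.
exists (fun i => v i 0) => [i|x [r ->]]; first exact: Qspan_entry.
have rowvalE (c : 'rV[rat]_n.+1) : \sum_i ratr (c 0 i) * v i 0 = rowval c v.
  by rewrite /rowval mxE; apply: eq_bigr => i _; rewrite mxE.
exists r; split=> // c; rewrite rowvalE => /eqP; rewrite -subr_eq0 => /eqP rc.
apply/subr0_eq/(rowval_eq0 (eigenvector1_neq0 eig) eig.1).
by rewrite /rowval map_mxB mulmxBl !mxE -[RHS]rc /rowval !mxE.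
Qed.

End Irreducible.

(** * Generated fields and normality *)

Lemma Qadjoin_sub (s : seq R) (F : {pred R}) : GRing.divring_closed F ->
  {subset s <= F} -> forall x, Qadjoin s x -> x \in F.
Proof. by move=> divF sF x /(_ F divF sF). Qed.

Lemma mem_Qadjoin (s : seq R) x : x \in s -> Qadjoin s x.
Proof. by move=> xs F _ sF; apply: sF. Qed.

Lemma divringD (F : {pred R}) x y : GRing.divring_closed F ->
  x \in F -> y \in F -> x + y \in F.
Proof.
move=> [F1 FB _] xF yF; have F0 : 0 \in F by rewrite -(subrr 1) FB.
by rewrite -[y]opprK FB // -sub0r FB.
Qed.

Lemma divringM (F : {pred R}) x y : GRing.divring_closed F ->
  x \in F -> y \in F -> x * y \in F.
Proof. by move=> [F1 _ Fd] xF yF; rewrite -[y]invrK Fd // -div1r Fd. Qed.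

Lemma divring_closed_ratr (F : {pred R}) q : GRing.divring_closed F -> ratr q \in F.
Proof.
case=> F1 FB Fdiv.
have F0 : 0 \in F by rewrite -(subrr 1) FB.
have FN x : x \in F -> - x \in F by move=> xF; rewrite -sub0r FB.
have Fnat m : m%:R \in F.
  by elim: m => // m IH; rewrite -addn1 natrD -[1%:R]opprK FB // FN.
have Fint (z : int) : z%:~R \in F.
  by case: z => m; [exact: Fnat | rewrite NegzE mulrNz FN // Fnat].
by rewrite /ratr Fdiv.
Qed.

(** The span is itself a field containing the generators, and every field containing the generators
    contains their rational combinations. *)
Lemma Qadjoin_Qspan n (B : 'M[rat]_n.+1) a v (s : seq R) :
  irreducible_poly (char_poly B) -> eigenvector1 B a v ->
  (forall x, x \in s -> Qspan v x) -> (forall i, v i 0 \in 1 :: s) ->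
  Qadjoin s = Qspan v.
Proof.
move=> irrB eig sv vs; apply/seteqP; split=> x.
  move=> /(Qadjoin_sub (Qspan_divring irrB eig)) H; apply/asboolP/H => y ys.
  by apply/asboolP/sv.
move=> [r ->] F divF sF; rewrite /rowval mxE.
have [F1 FB _] := divF.
apply: (big_ind (fun y => y \in F)) => [|y z|i _]; first by rewrite -(subrr 1) FB.
  exact: divringD.
apply: divringM => //; first by rewrite mxE divring_closed_ratr.
by move: (vs i); rewrite in_cons => /orP[/eqP ->|/sF].
Qed.

Lemma eqp_irreducible (p q : {poly rat}) :
  irreducible_poly p -> p %= q -> irreducible_poly q.
Proof.
move=> [p1 irr] pq; split=> [|d d1 dq]; first by rewrite -(eqp_size pq).
by apply: (eqp_trans _ pq); apply: irr => //; rewrite (eqp_dvdr _ pq).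
Qed.

Lemma normal_Qspan (B : 'M[rat]_4) a (v : 'cV[R]_4) (w w1 w2 w3 : R) :
  irreducible_poly (char_poly B) -> eigenvector1 B a v ->
  conjugates4 w w1 w2 w3 ->
  (forall x, x \in [:: w; w1; w2; w3] -> Qspan v x) -> normal_over_Q (Qspan v).
Proof.
move=> irrB eig [p irrp pE] wK.
split; first by move=> x; apply: (Qspan_algebraic irrB eig).
have v0 := eigenvector1_neq0 eig.
pose c (i : 'I_4) := nth 0 [:: w; w1; w2; w3] i.
have cK i : Qspan v (c i) by apply: wK; rewrite mem_nth.
have [h wh] : exists h, w = h^R.[a].
  by apply/(QspanP irrB eig)/wK; rewrite mem_head.
pose C := horner_mx B h.
have Cv : ratmx C *m v = w *: v by rewrite wh; apply: ratmx_horner_eigen eig.1.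
have pC : p^R = \prod_(i < 4) ('X - (c i)%:P).
  by rewrite pE !big_ord_recl big_ord0 mulr1 !mulrA.
have sp : size p = 5.
  by rewrite -(size_map_poly (ratr : {rmorphism rat -> R})) pC size_prod_XsubC
    [index_enum _]unlock -enumT size_enum_ord.
have pw : root p^R w by rewrite pE !rootM root_XsubC eqxx.
(* The irreducible [p] shares the root [w] with the characteristic polynomial of [C], hence divides
   it, and both have degree 4. *)
have pchi : p %= char_poly C.
  rewrite -dvdp_size_eqp ?size_char_poly ?sp //.
  by rewrite (irreducible_dvdp_root _ irrp pw) (eigen_root v0 Cv).
have irrC := eqp_irreducible irrp pchi.
have CE : char_poly (ratmx C) = \prod_(i < 4) ('X - (c i)%:P).
  apply/eqP; rewrite -eqp_monic ?char_poly_monic ?monic_prod_XsubC //.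
  by rewrite -map_char_poly -pC eqp_map eqp_sym.
have injc : injective c.
  move: CE; rewrite -map_char_poly => /(irreducible_roots_uniq irrC).
  by rewrite [index_enum _]unlock -enumT => /injectiveP.
have /choice[u uP] i : exists u : 'cV[R]_4, u != 0 /\ ratmx C *m u = c i *: u.
  have [|u u0 Cu] := @root_char_poly_eigen R 3 (ratmx C) (c i); last by exists u.
  by rewrite CE (bigD1 i) //= rootM root_XsubC eqxx.
pose P : 'M[R]_4 := \matrix_(i, j) u j i 0.
have colP j : col j P = u j by apply/colP => i; rewrite !mxE.
have Pu : P \in unitmx.
  apply: (eigenvectors_unitmx injc) => j; rewrite colP; first exact: (uP j).2.
  exact: (uP j).1.
move=> q irrq [x [r ->] qx].
(* As [v] is an eigenvector of [C] for [w], every element of the field is some [g(w)]; then [q]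
   divides the characteristic polynomial of [g(C)], whose roots are the [g(c i)]. *)
have [g gE] := rowval_horner irrC r.
have xE : rowval r v = g^R.[w] by apply: gE; split=> //; exact: eig.2.
have qD : q %| char_poly (horner_mx C g).
  rewrite (irreducible_dvdp_root _ irrq qx) xE.
  by apply: eigen_root v0 _; apply: ratmx_horner_eigen.
have : q^R %| \prod_(i < 4) ('X - (g^R.[c i])%:P).
  rewrite -(@char_poly_eigenbasis _ _ (ratmx (horner_mx C g)) P) //.
    by rewrite -map_char_poly dvdp_map.
  by move=> j; rewrite colP; apply: ratmx_horner_eigen; exact: (uP j).2.
(* A divisor of a product of linear factors is, up to a constant, the product of some of them. *)
move=> /dvdp_prod_XsubC[m]; set s := mask _ _ => qs.
exists [seq g^R.[c i] | i <- s]; last by rewrite big_map.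
by move=> y /mapP[i _ ->]; apply: (Qspan_horner irrB eig).
Qed.

End EigenField.

(** * Sails and integer matrices *)

Section Geometry.
Variable R : realType.
Local Open Scope classical_set_scope.
Implicit Types (X Y C : set 'cV[R]_4) (u : 'I_4 -> 'cV[R]_4).
Implicit Types (l : 'I_4 -> {vspace 'cV[R]_4}) (G : 'M[int]_4).

Lemma toRM m n p (A : 'M[int]_(m, n)) (B : 'M[int]_(n, p)) :
  toR R (A *m B) = toR R A *m toR R B.
Proof. exact: map_mxM. Qed.

Lemma toR1 n : toR R (1%:M : 'M[int]_n) = 1%:M.
Proof. exact: map_mx1. Qed.

Lemma toR_unitmx n (A : 'M[int]_n) : A \in unitmx -> toR R A \in unitmx.
Proof.
move=> Au; have := mulmxV Au => /(congr1 (toR R (n:=n))).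
by rewrite toRM toR1 => /mulmx1_unit[].
Qed.

Lemma mulmx_continuous m n (M : 'M[R]_(m, n)) :
  continuous (fun x : 'cV[R]_n => M *m x).
Proof.
have entry i j : continuous (fun x : 'cV[R]_n => (M *m x) i j).
  have sum_cont (s : seq 'I_n) :
      continuous (fun x : 'cV[R]_n => \sum_(k <- s) M i k * x k j).
    elim: s => [|k s IH].
      have -> : (fun x : 'cV[R]_n => \sum_(k <- [::]) M i k * x k j) = (fun=> 0).
        by apply/funext => x; rewrite big_nil.
      by move=> x; exact: cst_continuous.
    have -> : (fun x : 'cV[R]_n => \sum_(k' <- k :: s) M i k' * x k' j) =
        (fun x => M i k * x k j + \sum_(k <- s) M i k * x k j).
      by apply/funext => x; rewrite big_cons.
    by move=> x; apply: cvgD (IH x); apply: cvgMr; apply: coord_continuous.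
  have -> : (fun x : 'cV[R]_n => (M *m x) i j) =
      (fun x => \sum_k M i k * x k j) by apply/funext => x; rewrite mxE.
  exact: sum_cont.
move=> x N [P PN NP].
have : \forall z \near x, forall i j, P i j ((M *m z) i j).
  have nF : Filter (nbhs x) := nbhs_filter x.
  apply: (@filter_forall _ _ (fun i => [set z | forall j, P i j ((M *m z) i j)]) _ nF).
  move=> i; apply: (@filter_forall _ _ (fun j => [set z | P i j ((M *m z) i j)]) _ nF).
  by move=> j; apply: (entry i j x _ (PN i j)).
by apply: filterS => z Pz; apply: NP.
Qed.

(** Continuity of [M] carries closure points forward and pulls a neighbourhood inside [Y] back to
    one inside [X]. *)
Lemma boundary_mulmx (M : 'M[R]_4) X Y x :
  (forall z, X z <-> Y (M *m z)) -> boundary X x -> boundary Y (M *m x).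
Proof.
move=> XY [clX intX]; split.
  move=> N /(mulmx_continuous (x := x)) /clX[z [Xz Nz]].
  by exists (M *m z); split=> //; apply/XY.
apply: contra_not intX => /(mulmx_continuous (x := x)).
by apply: (@filterS _ _ (nbhs_filter x)) => z /= Yz; apply/XY.
Qed.

Lemma convE (x y : convex_lmodType 'cV[R]_4) (k : {i01 R}) :
  conv k x y = k%:num *: (x : 'cV[R]_4) + (1 - k%:num) *: (y : 'cV[R]_4).
Proof. by []. Qed.

(** The preimage under [M] of a convex set containing [Y] is convex and contains [X]. *)
Lemma conv_hull_mulmx (M : 'M[R]_4) X Y x :
  (forall z, X z -> Y (M *m z)) -> conv_hull X x -> conv_hull Y (M *m x).
Proof.
move=> XY hX Z [cZ YZ]; apply: (hX [set z | Z (M *m z)]); split.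
  move=> y z k; rewrite !in_setE /= => Zy Zz.
  rewrite convE mulmxDr -!scalemxAr; rewrite -in_setE.
  by apply: (cZ _ _ k); rewrite in_setE.
by move=> z Xz; apply/YZ/XY.
Qed.

Lemma klein_polyhedron_mulmx G C C' x : G \in unitmx ->
  (forall z, C z -> C' (toR R G *m z)) ->
  klein_polyhedron C x -> klein_polyhedron C' (toR R G *m x).
Proof.
move=> Gu CC'; apply: conv_hull_mulmx => z [[Cz [y _ yz]] z0]; split.
  by split; [apply: CC' | exists (G *m y); rewrite ?toRM ?yz].
move=> /= Gz0; apply: z0 => /=.
by rewrite -[z](mulKmx (toR_unitmx Gu)) Gz0 mulmx0.
Qed.

Lemma cone_mulmx (M : 'M[R]_4) u u' (s : 'S_4) x :
  (forall i, M *m u i = u' (s i)) -> cone u x -> cone u' (M *m x).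
Proof.
move=> uu' [t t0 ->]; exists (fun j => t (s^-1 j)%g) => //.
rewrite mulmx_sumr [RHS](reindex_inj (@perm_inj _ s)) /=; apply: eq_bigr => i _.
by rewrite permK -scalemxAr uu'.
Qed.

Lemma klein_cone_mulmx G u u' (s : 'S_4) x : G \in unitmx ->
  (forall i, toR R G *m u i = u' (s i)) ->
  klein_polyhedron (cone u) x <->
  klein_polyhedron (cone u') (toR R G *m x).
Proof.
move=> Gu uu'; split.
  by apply: klein_polyhedron_mulmx Gu _ => z; apply: cone_mulmx.
move=> Kx.
have VG : toR R (invmx G) *m toR R G = 1%:M by rewrite -toRM mulVmx ?toR1.
rewrite -[x]mul1mx -VG -mulmxA.
have Vu : invmx G \in unitmx by rewrite unitmx_inv.
apply: klein_polyhedron_mulmx Vu _ Kx => z.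
apply: (cone_mulmx (s := s^-1%g)) => i.
by rewrite -{1}[i](permKV s) -uu' mulmxA VG mul1mx.
Qed.

(** For such lines every choice of rays yields a sail, so a matrix permuting the lines sends sails
    to sails. *)
Definition irrational_lines l := forall u,
  (forall i, (u i \in l i) && (u i != 0)) -> irrational_cone u.

Lemma permutes_lines_mem l G s i (x : 'cV[R]_4) :
  permutes_lines l G s -> x \in l i -> toR R G *m x \in l (s i).
Proof.
move=> Gl xl; rewrite -Gl.
by have := memv_img (linfun (mulmx (toR R G))) xl; rewrite lfunE.
Qed.

Lemma permutes_lines_inv l G s : G \in unitmx ->
  permutes_lines l G s -> permutes_lines l (invmx G) s^-1.
Proof.
move=> Gu Gl i; rewrite -{1}[i](permKV s) -Gl -limg_comp.
have VG : toR R (invmx G) *m toR R G = 1%:M by rewrite -toRM mulVmx ?toR1.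
rewrite (_ : (_ \o _)%VF = \1%VF) ?lim1g //; apply/lfunP => x.
by rewrite comp_lfunE !lfunE /= mulmxA VG mul1mx.
Qed.

Lemma sail_mulmx l G s S : irrational_lines l -> G \in unitmx ->
  permutes_lines l G s -> sails l S ->
  exists2 S', sails l S' & forall x, S x -> S' (toR R G *m x).
Proof.
move=> irrl Gu Gl [u [ul _ ->]].
pose u' j := toR R G *m u (s^-1 j)%g.
have uu' i : toR R G *m u i = u' (s i) by rewrite /u' permK.
exists (boundary (klein_polyhedron (cone u'))) => [|x].
  have u'l i : (u' i \in l i) && (u' i != 0).
    have /andP[ui u0] := ul (s^-1 i)%g.
    rewrite -{1}[i in l i](permKV s) permutes_lines_mem //=.
    apply: contra_neq u0 => Gui0.
    by rewrite -[u _](mulKmx (toR_unitmx Gu)) [_ *m u _]Gui0 mulmx0.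
  by exists u'; split=> //; apply: irrl.
by apply: boundary_mulmx => z; apply: klein_cone_mulmx.
Qed.

(** Equality of sets follows from the inclusion for [G] and for its inverse. *)
Lemma CF_symmetry_permutes l G s : irrational_lines l -> G \in unitmx ->
  permutes_lines l G s -> CF_symmetry l G.
Proof.
move=> irrl Gu Gl; split=> //.
have sub H t : H \in unitmx -> permutes_lines l H t ->
    forall x, CF l x -> CF l (toR R H *m x).
  move=> Hu Hl x [S lS Sx].
  by have [S' lS' /(_ _ Sx)] := sail_mulmx irrl Hu Hl lS; exists S'.
apply/seteqP; split=> [_ [x CFx <-]|x CFx]; first exact: sub Gu Gl _ CFx.
exists (toR R (invmx G) *m x).
  apply: sub CFx; first by rewrite unitmx_inv.
  exact: permutes_lines_inv Gu Gl.
by rewrite mulmxA -toRM mulmxV // toR1 mul1mx.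
Qed.

(** * The Klein polyhedron of a single cone *)

Section Basis.
Variable u : 'I_4 -> 'cV[R]_4.
Let P : 'M[R]_4 := \matrix_(i, j) u j i 0.
Hypothesis Pu : P \in unitmx.

(* The sum of the coordinates of [x] in the basis [u]. *)
Definition coordsum (x : 'cV[R]_4) : R := ((const_mx 1 : 'rV_4) *m invmx P *m x) 0 0.

Lemma coordsumE (t : 'I_4 -> R) : coordsum (\sum_i t i *: u i) = \sum_i t i.
Proof.
have -> : \sum_i t i *: u i = P *m (\col_i t i).
  by rewrite mulmx_sum_col; apply: eq_bigr => i _; rewrite mxE; congr (_ *: _);
    apply/colP => j; rewrite !mxE.
rewrite /coordsum -mulmxA mulKmx // mxE.
by apply: eq_bigr => i _; rewrite !mxE mul1r.
Qed.

Lemma coordsumD x y a b : coordsum (a *: x + b *: y) = a * coordsum x + b * coordsum y.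
Proof. by rewrite /coordsum mulmxDr -!scalemxAr !mxE. Qed.

Lemma coordsum_continuous : continuous coordsum.
Proof.
move=> x; apply: (@continuous_comp _ _ _
  (fun x : 'cV[R]_4 => const_mx 1 *m invmx P *m x) (fun z : 'cV[R]_1 => z 0 0)).
  exact: mulmx_continuous.
exact: coord_continuous.
Qed.

Lemma lattice_coordsum : exists2 M : R, 0 < M &
  forall x, cone u x -> integer_points x -> x != 0 -> 1 <= M * coordsum x.
Proof.
(* [M] dominates every entry of every [u i], so each entry of [x] is at most [M * coordsum x] in
   absolute value, while some entry of a nonzero integer point is at least 1. The summand 1 makes
   [M] positive. *)
pose M := 1 + \sum_i \sum_j `|u i j 0|.
have M0 : 0 < M.
  by rewrite ltr_pwDl //; apply: sumr_ge0 => i _; apply: sumr_ge0.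
exists M => // x [t t0 xE] [z _ zx] x0.
have [j zj] : exists j, z j 0 != 0.
  apply/existsP; apply: contra_neqT x0; rewrite negb_exists => /forallP z0.
  rewrite -zx; apply/colP => i; rewrite !mxE.
  by have /negPn/eqP -> := z0 i.
have le1 : 1 <= `|x j 0|.
  rewrite -zx mxE -intr_norm -[1]/(1%:~R) ler_int.
  by rewrite -gtz0_ge1 normr_gt0.
apply: (le_trans le1); rewrite xE coordsumE summxE.
apply: (le_trans (ler_norm_sum _ _ _)); rewrite mulr_sumr; apply: ler_sum => i _.
rewrite mxE normrM (ger0_norm (t0 i)) mulrC ler_wpM2r // /M.
rewrite (bigD1 i) //= (bigD1 j) //= addrCA -!addrA ler_wpDr //.
by rewrite !addr_ge0 ?ler01 //; apply: sumr_ge0 => *; rewrite ?sumr_ge0.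
Qed.

(** The half-space [coordsum >= 1/M] is convex and contains the nonzero lattice points of the cone,
    hence the polyhedron, and it stays away from 0. Consequently points of a sail are nonzero. *)
Lemma klein_polyhedron_closure0 : ~ closure (klein_polyhedron (cone u)) 0.
Proof.
have [M M0 Mu] := lattice_coordsum => cl0.
have c0 : coordsum 0 = 0 by rewrite /coordsum mulmx0 mxE.
have : nbhs (0 : 'cV[R]_4) [set x | coordsum x < M^-1].
  apply: (@coordsum_continuous 0 [set z : R | z < M^-1]); rewrite c0.
  by apply: lt_nbhsl; rewrite invr_gt0.
move=> /cl0[x [Kx /=]]; rewrite ltNge => /negP; apply.
apply: (Kx [set x | M^-1 <= coordsum x]); split.
  move=> y z k; rewrite !in_setE /= convE coordsumD => yM zM.
  have -> : M^-1 = k%:num * M^-1 + (1 - k%:num) * M^-1 by ring.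
  by apply: lerD; apply: ler_wpM2l => //; rewrite subr_ge0.
move=> y [[uy iy] /eqP y0] /=.
by rewrite -[_ ^-1]mulr1 ler_pdivrMl // Mu.
Qed.

Lemma klein_polyhedron_cone x : klein_polyhedron (cone u) x -> cone u x.
Proof.
move=> Kx; apply: Kx; split; last by move=> z [[]].
move=> y z k; rewrite !in_setE => -[t t0 yE] [t' t'0 zE].
rewrite convE yE zE; exists (fun i => k%:num * t i + (1 - k%:num) * t' i) => [i|].
  by rewrite addr_ge0 // mulr_ge0 // subr_ge0.
rewrite !scaler_sumr -big_split; apply: eq_bigr => i _ /=.
by rewrite !scalerA -scalerDl.
Qed.

Lemma sail_fixed_point G (s : 'S_4) :
  (forall i, toR R G *m u i = u (s i)) -> integer_points (\sum_i u i) ->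
  exists2 x, boundary (klein_polyhedron (cone u)) x & toR R G *m x = x.
Proof.
move=> Gus; set y := \sum_i u i => iy.
have Gy : toR R G *m y = y.
  rewrite mulmx_sumr /y [RHS](reindex_inj (@perm_inj _ s)) /=.
  by apply: eq_bigr => i _; rewrite Gus.
have cy : coordsum y = 4.
  rewrite /y (eq_bigr (fun i => (1 : R) *: u i)) => [|i _]; last by rewrite scale1r.
  by rewrite coordsumE sumr_const card_ord.
have Ky : klein_polyhedron (cone u) y.
  move=> Z [_]; apply; split; last first.
    by move=> /= y0; move: cy; rewrite y0 /coordsum mulmx0 mxE => /eqP;
      rewrite eq_sym pnatr_eq0.
  by split=> //; exists (fun=> 1) => //; apply: eq_bigr => i _; rewrite scale1r.
(* The parameters at which the fixed ray lies in the polyhedron; they are nonnegative, and their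
   infimum gives the boundary point. *)
pose T := [set t : R | klein_polyhedron (cone u) (t *: y)].
have T0 t : T t -> 0 <= t.
  move=> /klein_polyhedron_cone[c c0 tc].
  have : 0 <= coordsum (t *: y) by rewrite tc coordsumE sumr_ge0.
  by rewrite /coordsum -scalemxAr mxE -/(coordsum y) cy pmulr_lge0.
have infT : has_inf T by split; [exists 1; rewrite /T /= scale1r | exists 0 => t /T0].
have scont (t : R) : {for t, continuous (fun t : R => t *: y)}.
  by apply: (@scalel_continuous R _ y).
exists (inf T *: y); last by rewrite -scalemxAr Gy.
split.
  (* Elements of [T] arbitrarily close to the infimum put the point in the closure. *)
  move=> N /(scont (inf T))/nbhs_ballP[e /= e0 eN].
  have [t Tt te] := inf_adherent e0 infT.
  exists (t *: y); split=> //; apply: eN; rewrite /ball /=.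
  by rewrite ler0_norm ?opprB ?ltrBlDl // subr_le0 ge_inf //; case: infT.
(* If the point were interior, the parameter [inf T - e / 2] would still belong to [T]. *)
move=> /(scont (inf T))/nbhs_ballP[e /= e0 eN].
have : T (inf T - e / 2).
  apply: eN; rewrite /ball /= opprB addrC subrK ger0_norm ?divr_ge0 ?ltW //.
  by rewrite gtr_pMr // invf_lt1 // ltr1n.
have [_ lbT] := infT.
by move/(ge_inf lbT); rewrite leNgt gtrBl divr_gt0.
Qed.

End Basis.
End Geometry.

(** * Lines of an algebraic continued fraction *)

Section Lines.
Variable R : realType.
Local Notation "p ^R" := (map_poly (ratr : rat -> R) p) (at level 2, format "p ^R").
Local Notation ratmx := (map_mx (ratr : rat -> R)).
Local Notation intq := (map_mx (intr : int -> rat)).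
Local Notation matcols u := (\matrix_(i < 4, j < 4) (u j i 0)).

Lemma ratmx_intq m n (M : 'M[int]_(m, n)) : ratmx (intq M) = toR R M.
Proof. by apply/matrixP => i j; rewrite !mxE ratr_int. Qed.

Lemma additive_fixes_int (K : set R) (s : R -> R) :
  (forall z : int, K z%:~R) -> s 1 = 1 ->
  (forall x y, K x -> K y -> s (x + y) = s x + s y) ->
  forall z : int, s z%:~R = z%:~R.
Proof.
move=> Kint s1 sD.
have s0 : s 0 = 0 by apply: (@addrI _ (s 0)); rewrite -sD ?addr0 //; apply: (Kint 0).
have snat n : s n%:R = n%:R.
  elim: n => [|n IH] //; rewrite -addn1 natrD sD ?IH ?s1 //.
    exact: (Kint n).
  exact: (Kint 1).
case=> n; first exact: snat.
rewrite NegzE mulrNz; apply: (@addIr _ (n.+1%:R)); rewrite addNr -[in LHS]snat.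
rewrite -sD ?addNr //; first by have := Kint (- n.+1%:Z); rewrite mulrNz.
exact: (Kint n.+1).
Qed.

Lemma eigenvector1_uniq n (B : 'M[rat]_n.+1) a (v v' : 'cV[R]_n.+1) :
  irreducible_poly (char_poly B) -> eigenvector1 B a v -> eigenvector1 B a v' ->
  v = v'.
Proof.
move=> irrB ev ev'; apply/colP => i.
have [h hE] := rowval_horner R irrB (delta_mx 0 i).
have entry (x : 'cV[R]_n.+1) : x i 0 = rowval (delta_mx 0 i) x.
  by rewrite /rowval map_delta_mx -rowE mxE.
by rewrite !entry (hE _ _ ev) (hE _ _ ev').
Qed.

Lemma eigenvector_entry_neq0 n (B : 'M[rat]_n.+1) a (v : 'cV[R]_n.+1)
    (r : 'rV[rat]_n.+1) :
  irreducible_poly (char_poly B) -> ratmx B *m v = a *: v -> v != 0 ->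
  r != 0 -> rowval r v != 0.
Proof. by move=> irrB Bv v0; apply: contra_neq => /(rowval_eq0 irrB v0 Bv). Qed.

Variables (l : 'I_4 -> {vspace 'cV[R]_4}) (A : 'M[int]_4) (a : 'I_4 -> R).
Hypothesis irrA : irreducible_poly (char_poly (intq A)).
Hypothesis eigA : eigenvalues A a.
Hypothesis lE : forall i, l i = passmx.leigenspace (linfun (mulmx (toR R A))) (a i).

Lemma mem_line i (x : 'cV[R]_4) : (x \in l i) = (toR R A *m x == a i *: x).
Proof.
by rewrite lE memv_ker !lfun_simp subr_eq0.
Qed.

Lemma eigenvalues_inj : injective a.
Proof.
have aE : (char_poly (intq A))^R = \prod_(i < 4) ('X - (a i)%:P).
  by rewrite map_char_poly ratmx_intq.
have := irreducible_roots_uniq irrA aE.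
by rewrite [index_enum _]unlock -enumT => /injectiveP.
Qed.

Lemma eigenvalue_index (x : 'cV[R]_4) b : x != 0 -> toR R A *m x = b *: x ->
  exists i, b = a i.
Proof.
move=> x0 /(eigen_char_poly_root x0); rewrite eigA => /rootP.
rewrite horner_prod => /eqP/prodf_eq0[i _]; rewrite hornerXsubC subr_eq0 => /eqP bi.
by exists i.
Qed.

Lemma lines_basis (u : 'I_4 -> 'cV[R]_4) :
  (forall i, (u i \in l i) && (u i != 0)) -> matcols u \in unitmx.
Proof.
move=> ul; have colu j : col j (matcols u) = u j by apply/colP => i; rewrite !mxE.
apply: (@eigenvectors_unitmx _ _ (toR R A) _ a eigenvalues_inj) => j; rewrite colu.
  by have /andP[] := ul j; rewrite mem_line => /eqP.
by have /andP[] := ul j.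
Qed.

(** The facet opposite to [u j] spans the kernel of the [j]-th row [f] of the inverse of the matrix
    of the [u i]. As a left eigenvector of [A], [f] has entries independent over the rationals, so
    it kills no nonzero integer vector. *)
Lemma algebraic_irrational_lines : irrational_lines l.
Proof.
move=> u ul j _ [z _ <-] zspan; have Pu := lines_basis ul.
set P := matcols u in Pu.
have colu i : u i = P *m delta_mx i 0 by rewrite -colE; apply/colP => k; rewrite !mxE.
pose f := row j (invmx P).
have fu i : f *m u i = (i == j)%:R%:M.
  rewrite colu /f -row_mul mulKmx //; apply/matrixP => p q.
  by rewrite !mxE !ord1 eqxx mulr1n andbT eq_sym.
have fA : f *m toR R A = a j *: f.
  apply: (can_inj (mulmxK Pu)); apply/matrixP => p i.
  have ent (g : 'rV[R]_4) : (g *m P) p i = (g *m u i) 0 0.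
    by rewrite !mxE ord1; apply: eq_bigr => k _; rewrite !mxE.
  rewrite !ent -mulmxA.
  have /andP[] := ul i; rewrite mem_line => /eqP -> _.
  rewrite -scalemxAr -scalemxAl fu !mxE.
  by case: eqP => [->|]; rewrite //= !mulr0n !mulr0.
have fz : f *m toR R z = 0.
  have /memv_sumP[y yl ->] := zspan; rewrite mulmx_sumr big1 // => i ij.
  have /vlineP[c ->] := yl i ij; rewrite -scalemxAr fu (negPf ij).
  by rewrite -scalemx1 !scale0r scaler0.
have irrT : irreducible_poly (char_poly (intq A)^T) by rewrite char_poly_tr.
have f0 : f^T != 0.
  apply/eqP => /(congr1 trmx); rewrite trmxK trmx0 => f0.
  have := fu j; rewrite f0 mul0mx eqxx => /matrixP/(_ 0 0); rewrite !mxE => /eqP.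
  by rewrite eq_sym oner_eq0.
have Tf : ratmx (intq A)^T *m f^T = a j *: f^T.
  by rewrite -map_trmx ratmx_intq -trmx_mul fA linearZ.
have : rowval (intq z^T) f^T = 0.
  by rewrite /rowval ratmx_intq /toR -map_trmx -trmx_mul fz trmx0 mxE.
move/(rowval_eq0 irrT f0 Tf) => z0; apply/matrixP => p q.
have := congr1 (fun M : 'rV[rat]_4 => M 0 p) z0; rewrite !mxE ord1 => /eqP.
by rewrite intr_eq0 => /eqP ->.
Qed.

(** A nonzero eigenvector has a nonzero first entry, so subtracting from [y] the multiple of [x]
    with the same first entry leaves 0. *)
Lemma line_vline i (x : 'cV[R]_4) : x \in l i -> x != 0 -> l i = <[x]>%VS.
Proof.
move=> xl x0; apply/vspaceP => y; apply/idP/vlineP => [yl|[c ->]]; last exact: memvZ.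
have nz (z : 'cV[R]_4) : z \in l i -> z != 0 -> z 0 0 != 0.
  move=> zl z0; have Az : ratmx (intq A) *m z = a i *: z.
    by rewrite ratmx_intq; apply/eqP; rewrite -mem_line.
  have -> : z 0 0 = rowval (delta_mx 0 0) z.
    by rewrite /rowval map_delta_mx -rowE mxE.
  apply: eigenvector_entry_neq0 irrA Az z0 _.
  by apply/eqP => /rowP/(_ 0); rewrite !mxE eqxx => /eqP; rewrite oner_eq0.
have x00 := nz x xl x0.
exists (y 0 0 / x 0 0); apply/eqP; rewrite -subr_eq0; apply/contraT => d0.
have /nz/(_ d0) : y - (y 0 0 / x 0 0) *: x \in l i by rewrite rpredB ?memvZ.
by rewrite !mxE divfK // subrr eqxx.
Qed.

(** * A symmetry built from four conjugate vectors *)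

Section Converse.
Variables (X : 'M[int]_4) (mu : R) (v : 'cV[R]_4) (G0 : 'M[int]_4).
Variables (W : 'I_4 -> 'cV[R]_4) (K : set R) (s : R -> R).
Hypothesis vl : v \in l ord0.
Hypotheses (Xu : X \in unitmx) (mu0 : mu != 0) (Xv : toR R X *m v = mu *: W 0).
Hypotheses (G0u : G0 \in unitmx) (GW : forall k, toR R G0 *m W k = W (k + 1)).
Hypotheses (W1 : forall k, W k 0 0 = 1) (injW : injective W).
Hypothesis sumW : integer_points (\sum_k W k).
Hypotheses (KD : forall x y, K x -> K y -> K (x + y))
  (KM : forall x y, K x -> K y -> K (x * y)) (Kint : forall z : int, K z%:~R).
Hypotheses (s1 : s 1 = 1)
  (sD : forall x y, K x -> K y -> s (x + y) = s x + s y)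
  (sM : forall x y, K x -> K y -> s (x * y) = s x * s y).
Hypotheses (WK : forall k i, K (W k i 0)) (sW : forall k i, s (W k i 0) = W (k + 1) i 0).

(** The integer matrix [B = X A X^-1] has [W 0] as an eigenvector, and applying [s] to the
    eigenvector equation passes from [W k] to [W (k + 1)]. So the [X^-1 W k] span the four lines,
    and [X^-1 G0 X] permutes them cyclically. *)
Lemma cyclic_proper_symmetry : exists G, proper_cyclic_symmetry l G.
Proof.
have sint := additive_fixes_int Kint s1 sD.
have s0 : s 0 = 0 := sint 0.
have K0 : K 0 := Kint 0.
have [Xi Xu' [XXi XiX]] : exists2 Y, Y \in unitmx & X *m Y = 1%:M /\ Y *m X = 1%:M.
  by exists (invmx X); rewrite ?unitmx_inv // mulmxV // mulVmx.
have XXiR : toR R X *m toR R Xi = 1%:M by rewrite -toRM XXi toR1.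
have XiXR : toR R Xi *m toR R X = 1%:M by rewrite -toRM XiX toR1.
pose B := X *m A *m Xi.
have irrB : irreducible_poly (char_poly (intq B)).
  rewrite (@char_poly_similar _ _ _ (intq X) (intq A)) //.
    by have := congr1 intq XXi; rewrite map_mxM map_mx1 => /mulmx1_unit[].
  by rewrite -!map_mxM /B -mulmxA XiX mulmx1.
have BW k : exists2 b, K b & toR R B *m W k = b *: W k.
  (* As the first entry of [W k'] is 1, the eigenvalue is the first entry of [B W k'], so it lies in
     [K], where [s] is multiplicative. *)
  have bK (b : R) k' : toR R B *m W k' = b *: W k' -> K b.
    move/matrixP/(_ 0 0); rewrite [RHS]mxE W1 mulr1 mxE => <-.
    by apply: (big_ind K) => // i _; apply: KM; rewrite ?mxE.
  have step k' : (exists2 b, K b & toR R B *m W k' = b *: W k') ->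
      exists2 b, K b & toR R B *m W (k' + 1) = b *: W (k' + 1).
    move=> [b Kb Bb]; suff E : toR R B *m W (k' + 1) = s b *: W (k' + 1).
      by exists (s b); rewrite ?E //; apply: bK E.
    apply/colP => i; have /colP/(_ i)/(congr1 s) := Bb.
    rewrite [in X in _ = X -> _]mxE sM // sW => sE; rewrite [RHS]mxE -sE !mxE.
    have : K (\sum_j toR R B i j * W k' j 0) /\
        s (\sum_j toR R B i j * W k' j 0) = \sum_j toR R B i j * W (k' + 1) j 0.
      apply: (big_ind2 (fun x y => K x /\ s x = y))
        => // [x y x' y' [Kx sx] [Kx' sx']|j _].
        by split; [apply: KD | rewrite sD ?sx ?sx'].
      have [KB sB] : K (toR R B i j) /\ s (toR R B i j) = toR R B i j.
        by rewrite mxE sint.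
      by split; [apply: KM | rewrite sM // sW sB].
    by case=> _ ->.
  have b0 : exists2 b, K b & toR R B *m W 0 = b *: W 0.
    have E : toR R B *m W 0 = a ord0 *: W 0.
      have Av : toR R A *m v = a ord0 *: v by apply/eqP; rewrite -mem_line.
      apply: (scalerI mu0); rewrite scalerA [mu * _]mulrC -scalerA -Xv scalemxAr -Xv.
      by rewrite /B !toRM -!mulmxA [toR R Xi *m _]mulmxA XiXR mul1mx Av scalemxAr.
    by exists (a ord0) => //; apply: bK E.
  have bn n : exists2 b, K b & toR R B *m W n%:R = b *: W n%:R.
    by elim: n => [//|n IH]; rewrite mulrSr; apply: step.
  by have := bn k; rewrite natr_Zp.
pose y k := toR R Xi *m W k.
have XyE k : toR R X *m y k = W k by rewrite /y mulmxA XXiR mul1mx.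
have y0 k : y k != 0.
  apply/eqP => yk; have := W1 k; rewrite -XyE yk mulmx0 mxE => /eqP.
  by rewrite eq_sym oner_eq0.
have Wline k k' b : toR R B *m W k = b *: W k -> toR R B *m W k' = b *: W k' -> k = k'.
  move=> E E'; apply: injW; apply: (eigenvector1_uniq (a := b) irrB).
    by split; rewrite ?ratmx_intq.
  by split; rewrite ?ratmx_intq.
(* [j k] is the index of the line carrying [y k]; it is injective because distinct [W k] have
   distinct eigenvalues. *)
have /choice[j jP] k : exists j, toR R B *m W k = a j *: W k.
  have [b _ Bb] := BW k; have [|i bi] := @eigenvalue_index (y k) b (y0 k).
    rewrite /y scalemxAr -Bb /B !toRM !mulmxA XiXR mul1mx -!mulmxA //.
  by exists i; rewrite -bi.
have injj : injective j.
  by move=> k k' jk; apply: Wline (jP k) _; rewrite jk; apply: jP.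
have yl k : y k \in l (j k).
  rewrite mem_line; apply/eqP; rewrite /y scalemxAr -jP /B !toRM !mulmxA XiXR mul1mx.
  by rewrite -!mulmxA.
pose pj := perm injj; pose c := perm (@addIr _ (1 : 'I_4)).
pose sg : 'S_4 := (pj^-1 * c * pj)%g.
have sgj k : sg (j k) = j (k + 1).
  have pjE k' : pj k' = j k' by rewrite permE.
  by rewrite /sg !permM -pjE permK -pjE; congr (pj _); rewrite permE.
have jV i : exists k, i = j k.
  by exists ((pj^-1)%g i); have := permKV pj i; rewrite permE => ->.
pose G := Xi *m G0 *m X.
have Gu : G \in unitmx by rewrite !unitmx_mul Xu' G0u Xu.
have Gy k : toR R G *m y k = y (k + 1).
  by rewrite /G !toRM -!mulmxA XyE GW.
have lj k : l (j k) = <[y k]>%VS by apply: line_vline.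
have Gl : permutes_lines l G sg.
  by move=> i; have [k ->] := jV i; rewrite sgj !lj limg_line lfunE /= Gy.
pose u i := y ((pj^-1)%g i).
have uj k : u (j k) = y k by rewrite /u -[j k](permE injj) permK.
have ul i : (u i \in l i) && (u i != 0).
  by have [k ->] := jV i; rewrite uj yl y0.
have irru := algebraic_irrational_lines ul.
exists G; split; first split.
- exact: CF_symmetry_permutes algebraic_irrational_lines Gu Gl.
- exists sg => //; apply/setP => i; rewrite inE.
  have [k0 ->] := jV ord0; have [k ->] := jV i.
  have sgX n : (sg ^+ n)%g (j k0) = j (k0 + n%:R).
    elim: n => [|n IH]; first by rewrite expg0 perm1 addr0.
    by rewrite expgSr permM IH sgj mulrSr addrA.
  have -> : j k = (sg ^+ (k - k0 : 'I_4)%R)%g (j k0).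
    by rewrite sgX natr_Zp addrC subrK.
  exact: mem_porbit.
- have [||x Sx Gx] := @sail_fixed_point R u (lines_basis ul) G sg.
  + by move=> i; have [k ->] := jV i; rewrite sgj !uj Gy.
  (* The sum of the [u i] is [X^-1] applied to the integer sum of the [W k]. *)
  + have [z _ zW] := sumW; exists (Xi *m z) => //.
    rewrite toRM zW mulmx_sumr [RHS](reindex_inj injj) /=.
    by apply: eq_bigr => k _; rewrite uj.
  by exists (boundary (klein_polyhedron (cone u))); [exists u | exists x].
Qed.

End Converse.
End Lines.

(** * Integer matrices of order four *)

Lemma sum4 (V : nmodType) (F : 'I_4 -> V) :
  \sum_i F i = F 0 + F 1 + F 2%:R + F 3%:R.
Proof.
rewrite !big_ord_recl big_ord0 addr0 !addrA.
by do ![congr (_ + _)]; congr F; apply: val_inj.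
Qed.

Ltac mx4_ring := apply/matrixP;
  do 2![case=> [[|[|[|[|?]]]] ?] //]; rewrite !mxE ?sum4 ?mxE /=; ring.

Section IntegerConjugacy.
Implicit Types (G M N V : 'M[int]_4).

Definition mx4 (rows : seq (seq int)) : 'M[int]_4 :=
  \matrix_(i, j) nth 0 (nth [::] rows i) j.

Definition conjugate M N := exists2 V, V \in unitmx & V *m M = N *m V.

Lemma conjugate_trans M N N' : conjugate M N -> conjugate N N' -> conjugate M N'.
Proof.
move=> [V Vu VM] [W Wu WN]; exists (W *m V); first by rewrite unitmx_mul Wu.
by rewrite -mulmxA VM mulmxA WN mulmxA.
Qed.

Lemma conjugateI V V' M N : V *m V' = 1%:M -> V *m M = N *m V -> conjugate M N.
Proof. by move=> /mulmx1_unit[Vu _] VM; exists V. Qed.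

Lemma mxtrace_conjugate M N : conjugate M N -> \tr N = \tr M.
Proof.
move=> [V Vu VM]; rewrite -[N](mulmxK Vu) -VM mxtrace_mulC mulmxA.
by rewrite mulVmx // mul1mx.
Qed.

Lemma conjugate_sqr M N : conjugate M N -> conjugate (M *m M) (N *m N).
Proof.
move=> [V Vu VM]; exists V => //.
by rewrite mulmxA VM -[_ *m V *m M]mulmxA VM mulmxA.
Qed.

(** In a Smith form [M = L D Q] some diagonal entry of [D] is 0, and the matching row of [L^-1]
    kills [M]; being a row of a unimodular matrix, it extends to an integer basis. *)
Lemma kernel_unimodular n (M : 'M[int]_n.+1) : \det M = 0 ->
  exists2 V, V \in unitmx & row 0 V *m M = 0.
Proof.
have [L Lu [Q Qu [d _ ->]]] := int_Smith_normal_form M.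
set D := \matrix_(i, j) _; rewrite !det_mulmx => /eqP.
have nz (U : 'M[int]_n.+1) : U \in unitmx -> \det U != 0.
  by rewrite unitmxE; apply: contraTneq => ->; rewrite unitr0.
rewrite !mulf_eq0 (negPf (nz _ Lu)) (negPf (nz _ Qu)) orbF /=.
have Ddiag : D = diag_mx (\row_i d`_i).
  by apply/matrixP => i j; rewrite !mxE.
rewrite Ddiag det_diag => /prodf_eq0[i _]; rewrite mxE => /eqP di.
exists (xrow 0 i (invmx L)).
  by rewrite xrowE unitmx_mul unitmx_perm unitmx_inv.
have -> : row 0 (xrow 0 i (invmx L)) = row i (invmx L).
  by apply/rowP => j; rewrite !mxE tpermL.
rewrite -row_mul -!mulmxA mulKmx // row_mul.
suff -> : row i (diag_mx (\row_i0 d`_i0)) = 0 by rewrite mul0mx.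
by apply/rowP => j; rewrite !mxE di mul0rn.
Qed.

(* The rows are the images under the symmetry of a basis [1, e, f, g], and [form3]
   is the case where [g] is the image of [f]. *)
Definition form8 (t k1 a1 p q k2 b1 r s : int) : 'M[int]_4 :=
  mx4 [:: [:: 1; 0; 0; 0]; [:: t; -1; 0; 0]; [:: k1; a1; p; q]; [:: k2; b1; r; s]].

Definition form3 t b k := form8 t 0 0 0 1 k b (-1) 0.

(* The symmetry in the basis [1, w, w', w''], where [w] has trace [T]. *)
Definition cyclic_form (T : int) : 'M[int]_4 :=
  mx4 [:: [:: 1; 0; 0; 0]; [:: 0; 0; 1; 0]; [:: 0; 0; 0; 1]; [:: T; -1; -1; -1]].

(* The symmetry in the basis [1, w, w', (w + w'' + d) / 2], where [w] has trace
   [2 c]. *)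
Definition split_form (d c : int) : 'M[int]_4 :=
  mx4 [:: [:: 1; 0; 0; 0]; [:: 0; 0; 1; 0]; [:: - d; -1; 0; 2]; [:: c + d; 0; 0; -1]].

(** [kernel_unimodular] is used twice: on [G - 1] to get a fixed first basis vector, then on the
    remaining 3 by 3 block plus 1 to get a second one that is negated modulo the first. *)
Lemma conjugate_form8 G : \det (G - 1%:M) = 0 -> \det (G + 1%:M) = 0 ->
  exists t k1 a1 p q k2 b1 r s, conjugate G (form8 t k1 a1 p q k2 b1 r s).
Proof.
move=> /kernel_unimodular[V Vu V0] detG1.
pose G1 := V *m G *m invmx V.
have VG : V *m G = G1 *m V by rewrite mulmxKV.
have G10 : row 0 G1 = row 0 1%:M.
  move/eqP: V0; rewrite mulmxBr mulmx1 subr_eq0 => /eqP V0.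
  by rewrite /G1 !row_mul V0 -row_mul mulmxV.
have detG1' : \det (G1 + 1%:M) = 0.
  have -> : G1 + 1%:M = V *m (G + 1%:M) *m invmx V.
    by rewrite mulmxDr mulmx1 mulmxDl mulmxV.
  by rewrite !det_mulmx detG1 mulr0 mul0r.
clearbody G1; pose H : 'M[int]_(1 + 3) := G1.
have HE : H = block_mx 1%:M 0 (dlsubmx H) (drsubmx H).
  rewrite -[LHS]submxK; congr block_mx; apply/matrixP => i j.
    have /rowP/(_ 0) := G10; rewrite !mxE !ord1 => E.
    by rewrite -[RHS]E; congr (G1 _ _); apply: val_inj.
  have /rowP/(_ (rshift 1 j)) := G10; rewrite !mxE ord1 => E.
  by rewrite -[RHS]E; congr (G1 _ _); apply: val_inj.
(* The corner contributes only a factor 2 to the determinant of [H + 1]. *)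
have : \det (drsubmx H + 1%:M) = 0.
  have : \det (H + 1%:M) = 0 by exact: detG1'.
  rewrite {1}HE (scalar_mx_block 1 3) add_block_mx addr0 addr0 det_lblock => /eqP.
  by rewrite mulf_eq0 det_mx11 !mxE /= => /eqP.
move=> /kernel_unimodular[U Uu]; rewrite mulmxDr mulmx1 => /eqP.
rewrite addr_eq0 => /eqP UH.
pose W : 'M[int]_(1 + 3) := block_mx 1%:M 0 0 U.
have Wu : W \in unitmx by rewrite unitmxE det_ublock det1 mul1r -unitmxE.
pose H2 : 'M[int]_(1 + 3) :=
  block_mx 1%:M 0 (U *m dlsubmx H) (U *m drsubmx H *m invmx U).
have WH : W *m H = H2 *m W.
  rewrite HE /W /H2 !mulmx_block !mul1mx !mul0mx !mulmx0 !mulmx1 !addr0 !add0r.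
  by rewrite mulmxKV.
have top j : H2 (lshift 3 0) j = (j == lshift 3 0)%:R.
  rewrite /H2; case: (split_ordP j) => k ->.
    by rewrite block_mxEul !mxE !ord1.
  by rewrite block_mxEur mxE.
have row1 j : H2 (rshift 1 0) (rshift 1 j) = - (j == 0)%:R.
  rewrite block_mxEdr.
  have /rowP/(_ j) : row 0 (U *m drsubmx H *m invmx U) = - row 0 1%:M.
    by rewrite !row_mul UH mulNmx -row_mul mulmxV.
  by rewrite [LHS]mxE => ->; rewrite !mxE eq_sym.
clearbody H2 W.
have e0 : lshift 3 (0 : 'I_1) = 0 :> 'I_4 by apply: val_inj.
have e1 : rshift 1 (0 : 'I_3) = 1 :> 'I_4 by apply: val_inj.
have e2 : rshift 1 (1 : 'I_3) = 2%:R :> 'I_4 by apply: val_inj.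
have e3 : rshift 1 (2%:R : 'I_3) = 3%:R :> 'I_4 by apply: val_inj.
have := (top (lshift 3 0), top (rshift 1 0), top (rshift 1 1), top (rshift 1 2%:R)).
have := (row1 0, row1 1, row1 2%:R).
rewrite e0 e1 e2 e3 => /= R1 R0.
exists (H2 1 0), (H2 2%:R 0), (H2 2%:R 1), (H2 2%:R 2%:R), (H2 2%:R 3%:R).
exists (H2 3%:R 0), (H2 3%:R 1), (H2 3%:R 2%:R), (H2 3%:R 3%:R).
apply: (@conjugate_trans _ G1); first by exists V.
exists W => //; rewrite [LHS]WH; congr (_ *m _).
apply/matrixP => i j; rewrite mxE.
have ordE (i0 : 'I_4) : [\/ i0 = 0, i0 = 1, i0 = 2%:R | i0 = 3%:R].
  by case: i0 => [[|[|[|[|?]]]] ?] //;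
    [apply: Or41 | apply: Or42 | apply: Or43 | apply: Or44]; apply: val_inj.
by case: (ordE i) => ->; case: (ordE j) => ->; rewrite /= ?R0 ?R1.
Qed.

(** * Explicit changes of basis *)

Lemma mx4_1 : 1%:M =
  mx4 [:: [:: 1; 0; 0; 0]; [:: 0; 1; 0; 0]; [:: 0; 0; 1; 0]; [:: 0; 0; 0; 1]].
Proof. by apply/matrixP; do 2![case=> [[|[|[|[|?]]]] ?] //]; rewrite !mxE. Qed.

(** The basis vector [g] is replaced by [g + m f]. *)
Lemma form8_shear t k1 a1 p q k2 b1 r s m :
  conjugate (form8 t k1 a1 p q k2 b1 r s)
    (form8 t k1 a1 (p - m * q) q
       (k2 + m * k1) (b1 + m * a1) (r + m * p - m * (s + m * q)) (s + m * q)).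
Proof.
apply: (@conjugateI
  (mx4 [:: [:: 1; 0; 0; 0]; [:: 0; 1; 0; 0]; [:: 0; 0; 1; 0]; [:: 0; 0; m; 1]])
  (mx4 [:: [:: 1; 0; 0; 0]; [:: 0; 1; 0; 0]; [:: 0; 0; 1; 0]; [:: 0; 0; -m; 1]])).
  rewrite mx4_1; mx4_ring.
mx4_ring.
Qed.

Lemma form8_swap t k1 a1 p q k2 b1 r s :
  conjugate (form8 t k1 a1 p q k2 b1 r s) (form8 t k2 b1 s r k1 a1 q p).
Proof.
apply: (@conjugateI
  (mx4 [:: [:: 1; 0; 0; 0]; [:: 0; 1; 0; 0]; [:: 0; 0; 0; 1]; [:: 0; 0; 1; 0]])
  (mx4 [:: [:: 1; 0; 0; 0]; [:: 0; 1; 0; 0]; [:: 0; 0; 0; 1]; [:: 0; 0; 1; 0]])).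
  rewrite mx4_1; mx4_ring.
mx4_ring.
Qed.

(** The new last basis vector is the image [k1 + a1 e + p f + q g] of [f], a unimodular change as
    [q] is a unit. *)
Lemma form8_form3 t k1 a1 p q k2 b1 r : `|q|%N = 1%N -> p ^+ 2 + q * r = -1 ->
  exists b k, conjugate (form8 t k1 a1 p q k2 b1 r (- p)) (form3 t b k).
Proof.
move=> q1 pqr; exists (p * a1 + q * b1 - a1), (k1 + a1 * t + p * k1 + q * k2).
have rE : r = - q * (1 + p ^+ 2) by nia.
apply: (@conjugateI
  (mx4 [:: [:: 1; 0; 0; 0]; [:: 0; 1; 0; 0]; [:: 0; 0; 1; 0]; [:: k1; a1; p; q]])
  (mx4 [:: [:: 1; 0; 0; 0]; [:: 0; 1; 0; 0]; [:: 0; 0; 1; 0];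
    [:: - q * k1; - q * a1; - q * p; q]])).
  rewrite mx4_1; have [->|->] : q = 1 \/ q = -1 by lia.
    mx4_ring.
  mx4_ring.
rewrite rE; have [->|->] : q = 1 \/ q = -1 by lia.
  mx4_ring.
mx4_ring.
Qed.

(* Reduction of the definite binary form [q x^2 - 2 p x y - r y^2], of determinant
   [1]: after replacing [p] by [p mod q], [|q r| = p^2 + 1] gives [|r| < |q|]. *)
Lemma form8_reduce t k1 a1 p q k2 b1 r : p ^+ 2 + q * r = -1 ->
  exists b k, conjugate (form8 t k1 a1 p q k2 b1 r (- p)) (form3 t b k).
Proof.
have [n] := ubnP `|q|%N; elim: n => // n IH in k1 a1 p q k2 b1 r *.
move=> qn pqr.
have [q1|q1] := eqVneq `|q|%N 1%N.
  exact: form8_form3.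
have q0 : q != 0 by apply: contra_eq_neq pqr => ->; nia.
pose m := (p %/ q)%Z; pose p' := (p %% q)%Z.
have p'E : p - m * q = p' by rewrite [in LHS](divz_eq p q) addrC addKr.
pose r' := r + m * p - m * (- p + m * q).
have pqr' : p' ^+ 2 + q * r' = -1 by rewrite -p'E -pqr /r'; ring.
(* After exchanging [f] and [g], [r'] stands in the place of [q], so the induction continues with
   the smaller [|r'|]. *)
have [b [k Hbk]] : exists b k, conjugate
    (form8 t (k2 + m * k1) (b1 + m * a1) (- p') r' k1 a1 q (- - p')) (form3 t b k).
  apply: IH; last by rewrite -pqr'; ring.
  have p'0 : 0 <= p' by apply: modz_ge0.
  have p'q : p' < `|q| by apply: ltz_mod.
  (* Indeed [|q| |r'| = p'^2 + 1 <= (|q| - 1)^2 + 1 < |q|^2] because [|q| >= 2]. *)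
  suff : `|r'| < `|q| by lia.
  have : `|q| * `|r'| = p' ^+ 2 + 1.
    by rewrite -normrM (_ : q * r' = - (p' ^+ 2 + 1)) ?normrN ?ger0_norm //; nia.
  have : 2 <= `|q| by lia.
  move: `|r'| `|q| p'q => x y; nia.
exists b, k; apply: conjugate_trans Hbk.
apply: conjugate_trans (form8_shear _ _ _ _ _ _ _ _ _ m) _.
rewrite p'E -/r' (_ : - p + m * q = - p'); last by rewrite -p'E; ring.
by rewrite opprK; apply: form8_swap.
Qed.

(** The new basis is 1, [e + n], [f + c e + m] and the image of the latter. It allows [t], [b] and
    [k] to be reduced modulo 2. *)
Lemma form3_shift t b k n m c : conjugate (form3 t b k)
  (form3 (t + 2 * n) (b + 2 * c) (k + 2 * m - (b + 2 * c) * n)).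
Proof.
apply: (@conjugateI
  (mx4 [:: [:: 1; 0; 0; 0]; [:: n; 1; 0; 0]; [:: m; c; 1; 0];
    [:: m + c * t; - c; 0; 1]])
  (mx4 [:: [:: 1; 0; 0; 0]; [:: - n; 1; 0; 0]; [:: c * n - m; - c; 1; 0];
    [:: - m - c * t - c * n; c; 0; 1]])).
  rewrite mx4_1; mx4_ring.
mx4_ring.
Qed.

(** For [b = 1] the image of [g] is [k + e - f], so 1, [f], [g] and this image form a basis; the
    orbit of [f] has sum [t + 2 k]. *)
Lemma form3_cyclic t k : conjugate (form3 t 1 k) (cyclic_form (t + 2 * k)).
Proof.
apply: (@conjugateI
  (mx4 [:: [:: 1; 0; 0; 0]; [:: 0; 0; 1; 0]; [:: 0; 0; 0; 1]; [:: k; 1; -1; 0]])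
  (mx4 [:: [:: 1; 0; 0; 0]; [:: - k; 1; 0; 1]; [:: 0; 1; 0; 0]; [:: 0; 0; 1; 0]])).
  rewrite mx4_1; mx4_ring.
mx4_ring.
Qed.

(** Replacing [w] by [w + n] adds [4 n] to the trace. *)
Lemma cyclic_form_shift T n : conjugate (cyclic_form T) (cyclic_form (T + 4 * n)).
Proof.
apply: (@conjugateI
  (mx4 [:: [:: 1; 0; 0; 0]; [:: n; 1; 0; 0]; [:: n; 0; 1; 0]; [:: n; 0; 0; 1]])
  (mx4 [:: [:: 1; 0; 0; 0]; [:: -n; 1; 0; 0]; [:: -n; 0; 1; 0]; [:: -n; 0; 0; 1]])).
  rewrite mx4_1; mx4_ring.
mx4_ring.
Qed.

Lemma cyclic_form_opp T : conjugate (cyclic_form T) (cyclic_form (- T)).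
Proof.
pose V := mx4 [:: [:: 1; 0; 0; 0]; [:: 0; -1; 0; 0]; [:: 0; 0; -1; 0]; [:: 0; 0; 0; -1]].
apply: (@conjugateI V V); first by rewrite mx4_1; mx4_ring.
mx4_ring.
Qed.

(** Put [w = e + f]. Its image is [t - e + g] and its second image is [e - f], so
    [e = (w + w'') / 2] and the trace is [2 t]. *)
Lemma form3_split0 t : conjugate (form3 t 0 0) (split_form 0 t).
Proof.
apply: (@conjugateI
  (mx4 [:: [:: 1; 0; 0; 0]; [:: 0; 1; 1; 0]; [:: t; -1; 0; 1]; [:: 0; 1; 0; 0]])
  (mx4 [:: [:: 1; 0; 0; 0]; [:: 0; 0; 0; 1]; [:: 0; 1; 0; -1]; [:: -t; 0; 1; 1]])).
  rewrite mx4_1; mx4_ring.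
mx4_ring.
Qed.

(** Again [w = e + f], but now [w'' = e + 1 - f], so [e + 1 = (w + w'' + 1) / 2] and the trace is
    [2 (t + 1)]. *)
Lemma form3_split1 t : conjugate (form3 t 0 1) (split_form 1 (t + 1)).
Proof.
apply: (@conjugateI
  (mx4 [:: [:: 1; 0; 0; 0]; [:: 0; 1; 1; 0]; [:: t; -1; 0; 1]; [:: 1; 1; 0; 0]])
  (mx4 [:: [:: 1; 0; 0; 0]; [:: -1; 0; 0; 1]; [:: 1; 1; 0; -1]; [:: -t - 1; 0; 1; 1]])).
  rewrite mx4_1; mx4_ring.
mx4_ring.
Qed.

Inductive order4_form : 'M[int]_4 -> Prop :=
| Cyclic0 : order4_form (cyclic_form 0)
| Cyclic1 : order4_form (cyclic_form 1)
| Cyclic2 : order4_form (cyclic_form 2)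
| Split00 : order4_form (split_form 0 0)
| Split01 : order4_form (split_form 0 1)
| Split10 : order4_form (split_form 1 0)
| Split11 : order4_form (split_form 1 1).

(** An odd [b] is reduced to 1 and gives a cyclic form, with trace modulo 4 and up to sign; an even
    [b] is reduced to 0 and leaves [t] and [k] modulo 2. *)
Lemma form3_order4 t b k : exists2 N, order4_form N & conjugate (form3 t b k) N.
Proof.
have bE := divz_eq b 2; have b2 := modz_ge0 b (isT : 2 != 0 :> int).
have b2' := ltz_pmod b (isT : 0 < 2 :> int).
have [[c bc]|[c bc]] : (exists c, b + 2 * c = 1) \/ (exists c, b + 2 * c = 0).
- have [b0|b1] : (b %% 2)%Z = 0 \/ (b %% 2)%Z = 1 by lia.
    by right; exists (- (b %/ 2)%Z); lia.
  by left; exists (- (b %/ 2)%Z); lia.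
- have C : conjugate (form3 t b k) (cyclic_form (t + 2 * k)).
    apply: conjugate_trans (form3_shift t b k 0 0 c) _; rewrite bc.
    rewrite (_ : t + _ = t); last by ring.
    by rewrite (_ : k + _ - _ = k); [apply: form3_cyclic | ring].
  have TE := divz_eq (t + 2 * k) 4; set T := t + 2 * k in C TE.
  have T2 := modz_ge0 T (isT : 4 != 0 :> int).
  have T2' := ltz_pmod T (isT : 0 < 4 :> int).
  have C' n : conjugate (form3 t b k) (cyclic_form (T + 4 * n)).
    exact: conjugate_trans C (cyclic_form_shift _ _).
  have := C' (- (T %/ 4)%Z); rewrite (_ : T + _ = (T %% 4)%Z); last by lia.
  have [-> | [-> | [-> | ->]]] : (T %% 4)%Z = 0 \/ (T %% 4)%Z = 1 \/
    (T %% 4)%Z = 2 \/ (T %% 4)%Z = 3 by lia.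
  + by exists (cyclic_form 0) => //; constructor.
  + by exists (cyclic_form 1) => //; constructor.
  + by exists (cyclic_form 2) => //; constructor.
  (* Trace 3 becomes -3 by a change of sign, then 1 by adding 4. *)
  + move=> C3; exists (cyclic_form 1); first by constructor.
    apply: conjugate_trans C3 _; apply: conjugate_trans (cyclic_form_opp _) _.
    exact: (cyclic_form_shift (-3) 1).
- have C n m : conjugate (form3 t b k) (form3 (t + 2 * n) 0 (k + 2 * m)).
    have := form3_shift t b k n m c; rewrite bc.
    by rewrite (_ : k + _ - _ = k + 2 * m) //; ring.
  have kE := divz_eq k 2; have k2 := modz_ge0 k (isT : 2 != 0 :> int).
  have k2' := ltz_pmod k (isT : 0 < 2 :> int).
  have tE := divz_eq t 2; have t2 := modz_ge0 t (isT : 2 != 0 :> int).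
  have t2' := ltz_pmod t (isT : 0 < 2 :> int).
  have := C (- (t %/ 2)%Z) (- (k %/ 2)%Z).
  rewrite (_ : t + _ = (t %% 2)%Z); last by lia.
  rewrite (_ : k + _ = (k %% 2)%Z); last by lia.
  have [k0|k1] : (k %% 2)%Z = 0 \/ (k %% 2)%Z = 1 by lia.
    rewrite k0.
    have [-> | ->] : (t %% 2)%Z = 0 \/ (t %% 2)%Z = 1 by lia.
      exists (split_form 0 0); first by constructor.
      by apply: conjugate_trans (form3_split0 _).
    exists (split_form 0 1); first by constructor.
    by apply: conjugate_trans (form3_split0 _).
  rewrite k1.
  have [-> | ->] : (t %% 2)%Z = 0 \/ (t %% 2)%Z = 1 by lia.
    exists (split_form 1 1); first by constructor.
    by apply: conjugate_trans (form3_split1 0).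
  (* At [t = 1] the split form would have [c = 2]; shifting [t] to -1 gives [c = 0] instead. *)
  move=> C1; exists (split_form 1 0); first by constructor.
  apply: conjugate_trans C1 _.
  apply: conjugate_trans (form3_shift 1 0 1 (-1) 0 0) _.
  exact: (form3_split1 (-1)).
Qed.

(** The two traces say that the 2 by 2 block satisfies [s = -p] and [p^2 + q r = -1], that is, has
    square -1. *)
Lemma order4_classification G : \det (G - 1%:M) = 0 -> \det (G + 1%:M) = 0 ->
  \tr G = 0 -> \tr (G *m G) = 0 -> exists2 N, order4_form N & conjugate G N.
Proof.
move=> d1 d2 tr1 tr2.
have [t [k1 [a1 [p [q [k2 [b1 [r [s GM]]]]]]]]] := conjugate_form8 d1 d2.
have := mxtrace_conjugate GM; have := mxtrace_conjugate (conjugate_sqr GM).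
rewrite tr1 tr2 /mxtrace !sum4 !mxE !sum4 !mxE /= => tr2' tr1'.
have sp : s = - p by lia.
rewrite sp in GM tr2'.
have [|b [k C]] := @form8_reduce t k1 a1 p q k2 b1 r; first by nia.
have [N HN C'] := form3_order4 t b k.
by exists N => //; apply: conjugate_trans GM (conjugate_trans C C').
Qed.

End IntegerConjugacy.

(** * Conjugates and the field automorphism *)

Section Conjugates.
Variable R : realType.
Local Notation "p ^R" := (map_poly (ratr : rat -> R) p) (at level 2, format "p ^R").
Local Notation ratmx := (map_mx (ratr : rat -> R)).

Lemma Qadjoin_divring (s : seq R) : GRing.divring_closed [pred x | `[< Qadjoin s x >]].
Proof.
split; first by apply/asboolP => F [].
- move=> x y /asboolP Kx /asboolP Ky; apply/asboolP => F divF sF.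
  by case: (divF) => _ FB _; apply: FB; [apply: Kx | apply: Ky].
- move=> x y /asboolP Kx /asboolP Ky; apply/asboolP => F divF sF.
  by case: (divF) => _ _ Fd; apply: Fd; [apply: Kx | apply: Ky].
Qed.

Variables (B : 'M[rat]_4) (b : nat -> R) (y : nat -> 'cV[R]_4) (N : 'M[rat]_4).
Hypothesis irrB : irreducible_poly (char_poly B).
Hypothesis eigB : forall k, eigenvector1 B (b k) (y k).
Hypothesis yS : forall k, y k.+1 = ratmx N *m y k.
Hypothesis y4 : forall k, y (k + 4)%N = y k.
Hypothesis injb : injective (fun i : 'I_4 => b i).

Let s := conj_map (b 0%N) (b 1%N).
Let V := Qspan (y 0%N).

Let root_b k : root (char_poly B)^R (b k).
Proof. exact: eigenvector1_root (eigB k). Qed.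

Let sE h : s h^R.[b 0%N] = h^R.[b 1%N].
Proof. exact: conj_mapE irrB (root_b 0) (root_b 1). Qed.

Lemma rowval_shift r k : rowval r (y k) = rowval (r *m N ^+ k) (y 0%N).
Proof.
elim: k r => [|k IH] r; first by rewrite expr0 mulmx1.
by rewrite exprS mulmxA -IH /rowval yS map_mxM !mulmxA.
Qed.

(** The argument of [s] is a rational form in [y 0], hence a polynomial in [b 0]; replacing [b 0] by
    [b 1] turns [y 0] into [y 1]. *)
Lemma conj_map_rowval r k : s (rowval r (y k)) = rowval r (y k.+1).
Proof.
rewrite rowval_shift; have [h hE] := rowval_horner R irrB (r *m N ^+ k).
rewrite (hE _ _ (eigB 0)) sE -(hE _ _ (eigB 1)).
rewrite [RHS]rowval_shift exprSr mulmxA /rowval.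
by rewrite [ratmx (_ *m N)]map_mxM -mulmxA -yS.
Qed.

Let VP x : V x <-> exists h, x = h^R.[b 0%N].
Proof. exact: (QspanP irrB (eigB 0)). Qed.

Let s1 : s 1 = 1.
Proof. by have := sE 1; rewrite rmorph1 !hornerC. Qed.

Let sD u v : V u -> V v -> s (u + v) = s u + s v.
Proof.
move=> /VP[h ->] /VP[g ->].
by rewrite -hornerD -rmorphD !sE rmorphD hornerD.
Qed.

Let sM u v : V u -> V v -> s (u * v) = s u * s v.
Proof.
move=> /VP[h ->] /VP[g ->].
by rewrite -hornerM -rmorphM !sE rmorphM hornerM.
Qed.

Let sB u v : V u -> V v -> s (u - v) = s u - s v.
Proof.
move=> /VP[h ->] /VP[g ->].
by rewrite -hornerN -hornerD -rmorphB !sE rmorphB hornerD hornerN.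
Qed.

Let sV u : V u -> s u^-1 = (s u)^-1.
Proof.
move=> /VP[h ->]; have [g gE] := ratr_horner_inv h irrB (root_b 0).
by rewrite -gE // !sE gE.
Qed.

Let divV : GRing.divring_closed [pred x | `[< V x >]].
Proof. exact: (Qspan_divring irrB (eigB 0)). Qed.

Variable r : 'rV[rat]_4.
Let w k := rowval r (y k).

Let Vw k : V (w k).
Proof. by exists (r *m N ^+ k); rewrite /w rowval_shift. Qed.

Let w4 k : w (k + 4)%N = w k.
Proof. by rewrite /w y4. Qed.

Lemma cyclically_ordered_rowval : cyclically_ordered (w 0%N) (w 1%N) (w 2%N) (w 3%N).
Proof.
have KV x : Qadjoin [:: w 0%N; w 1%N; w 2%N; w 3%N] x -> V x.
  move/(Qadjoin_sub divV) => H; apply/asboolP/H => z.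
  by rewrite !inE => /or4P[]/eqP ->; do 2 apply/asboolP; apply: Vw.
have sw k : s (w k) = w k.+1 by exact: conj_map_rowval.
have w40 : w 4%N = w 0%N := w4 0.
have wK k : (k < 4)%N -> Qadjoin [:: w 0%N; w 1%N; w 2%N; w 3%N] (w k).
  by move: k => [|[|[|[|?]]]] // _; apply: mem_Qadjoin; rewrite !inE eqxx ?orbT.
exists s; split; rewrite ?s1 //; last by rewrite !sw.
- move=> x Kx.
  set K := Qadjoin _ in KV wK Kx *.
  have divK : GRing.divring_closed [pred x | `[< K x >]] by apply: Qadjoin_divring.
  have [K1 KB Kd] := divK.
  (* The elements of [V] that [s] sends into [K] form a field containing the generators, hence all
     of [K]; [V] is where [s] is known to be a homomorphism. *)
  pose F := [pred x | `[< V x /\ K (s x) >]].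
  have divF : GRing.divring_closed F.
    have [V1 VB Vd] := divV.
    split; first by apply/asboolP; split; [apply/asboolP | rewrite s1; apply/asboolP].
    - move=> u v /asboolP[Vu Ku] /asboolP[Vv Kv]; apply/asboolP; split.
        by apply/asboolP/VB; apply/asboolP.
      by rewrite sB //; apply/asboolP/KB; apply/asboolP.
    - move=> u v /asboolP[Vu Ku] /asboolP[Vv Kv]; apply/asboolP; split.
        by apply/asboolP/Vd; apply/asboolP.
      rewrite sM ?sV //; first by apply/asboolP/Kd; apply/asboolP.
      by apply/asboolP; rewrite -[v^-1]div1r; apply: Vd => //; apply/asboolP.
  have /asboolP[] // : x \in F.
  apply: Kx => // z; rewrite !inE => /or4P[]/eqP ->; do 2 apply/asboolP;
    by split; [exact: Vw | rewrite sw ?w40; apply: wK].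
- by move=> u v /KV Vu /KV; apply: sD.
- by move=> u v /KV Vu /KV; apply: sM.
Qed.

(** The characteristic polynomial of [C = h(B)] has the four distinct roots [w k]. A nonconstant
    rational factor vanishes at one of them; [s] moves its roots along the cycle, so it has all four
    and full degree. *)
Lemma conjugates4_rowval : w 0%N != w 1%N -> w 0%N != w 2%N ->
  conjugates4 (w 0%N) (w 1%N) (w 2%N) (w 3%N).
Proof.
move=> w01 w02.
have sw k : s (w k) = w k.+1 by exact: conj_map_rowval.
have w40 : w 4%N = w 0%N := w4 0.
have wS j k : w j = w k -> w j.+1 = w k.+1 by rewrite -!sw => ->.
(* Since [s] shifts indices, any coincidence propagates around the cycle to one excluded by the
   hypotheses. *)
have w_inj : uniq [:: w 0%N; w 1%N; w 2%N; w 3%N].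
  have w50 : w 5%N = w 1%N := w4 1.
  rewrite /= !inE !negb_or w01 w02 !andbT.
  have w03 : w 0%N != w 3%N.
    by apply: contra_neq w01 => /wS; rewrite w40.
  have w12 : w 1%N != w 2%N.
    by apply: contra_neq w01 => /wS/wS/wS; rewrite w40 w50.
  have w13 : w 1%N != w 3%N.
    by apply: contra_neq w02 => /wS; rewrite w40 => ->.
  have w23 : w 2%N != w 3%N.
    by apply: contra_neq w03 => /wS; rewrite w40 => ->.
  by rewrite w03 w12 w13 w23.
have [h hE] := rowval_horner R irrB r.
have wE k : w k = h^R.[b k] by apply: hE (eigB k).
pose C := horner_mx B h.
have CE : (char_poly C)^R = \prod_(z <- [:: w 0%N; w 1%N; w 2%N; w 3%N]) ('X - z%:P).
  pose P : 'M[R]_4 := \matrix_(i, j) y j i 0.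
  have colP j : col j P = y j by apply/colP => i; rewrite !mxE.
  have Pu : P \in unitmx.
    apply: (@eigenvectors_unitmx _ _ (ratmx B) _ _ injb) => j; rewrite colP.
      exact: (eigB j).1.
    exact: eigenvector1_neq0 (eigB j).
  rewrite map_char_poly (@char_poly_eigenbasis _ _ _ P (fun i : 'I_4 => w i)) //.
    by rewrite !big_ord_recl big_ord0 !big_cons big_nil.
  by move=> j; rewrite colP wE; apply: ratmx_horner_eigen; exact: (eigB j).1.
exists (char_poly C); last by rewrite CE !big_cons big_nil mulr1 !mulrA.
split; first by rewrite size_char_poly.
move=> q q1 qC.
have q0 : q != 0.
  apply: contraTneq qC => ->; rewrite dvd0p.
  by rewrite -size_poly_gt0 size_char_poly.
have qS k : root q^R (w k) -> root q^R (w k.+1).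
  have [g gE] : exists g, w k = g^R.[b 0%N] by apply/VP/Vw.
  rewrite -[w k.+1]sw gE /root sE => /eqP qg.
  have := congr1 s qg; rewrite -horner_comp -map_comp_poly sE.
  have -> : s 0 = 0 by have := sE 0; rewrite rmorph0 !horner0.
  by rewrite map_comp_poly horner_comp => ->.
have [k [kl qk]] : exists k, (k < 4)%N /\ root q^R (w k).
  have : q^R %| \prod_(z <- [:: w 0%N; w 1%N; w 2%N; w 3%N]) ('X - z%:P).
    by rewrite -CE dvdp_map.
  move=> /dvdp_prod_XsubC[m]; set t := mask m _ => qt.
  have : (0 < size t)%N.
    case Et : t qt => [|z t'] //; rewrite big_nil => /eqp_size.
    by rewrite size_map_poly size_poly1 => /eqP; rewrite (negPf q1).
  case Et : t qt => [|z t'] // qt _.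
  have qz : root q^R z.
    by rewrite (eqp_root qt) big_cons rootM root_XsubC eqxx.
  have : z \in t by rewrite Et mem_head.
  move/mem_mask; rewrite !inE => /or4P[]/eqP zE; rewrite zE in qz.
  + by exists 0%N.
  + by exists 1%N.
  + by exists 2%N.
  + by exists 3%N.
have qall j : root q^R (w (k + j)%N).
  by elim: j => [|j IH]; rewrite ?addn0 // addnS; apply: qS.
have q_w j : (j < 4)%N -> root q^R (w j).
  move=> jl; have := qall (4 - k + j)%N.
  by rewrite addnA subnKC 1?ltnW // addnC w4.
have q5 : (4 < size q)%N.
  rewrite -(size_map_poly (ratr : {rmorphism rat -> R})).
  apply: (@max_poly_roots _ _ [:: w 0%N; w 1%N; w 2%N; w 3%N]) => //.
    by rewrite map_poly_eq0.
  by rewrite /= !q_w.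
rewrite -dvdp_size_eqp // eqn_leq size_char_poly q5 andbT.
have := dvdp_leq _ qC; rewrite size_char_poly; apply.
by rewrite -size_poly_gt0 size_char_poly.
Qed.

End Conjugates.

(** * Coordinates adapted to a cyclic symmetry *)

Section Forward.
Variable R : realType.
Local Notation ratmx := (map_mx (ratr : rat -> R)).
Local Notation intq := (map_mx (intr : int -> rat)).

Lemma det_eq0_kernel (F : fieldType) n (M : 'M[F]_n) (x : 'cV_n) :
  x != 0 -> M *m x = 0 -> \det M = 0.
Proof.
move=> x0 Mx; apply/eqP/contraT => dM; case/eqP: x0.
have Mu : M \in unitmx by rewrite unitmxE unitfE.
by rewrite -(mulKmx Mu x) Mx mulmx0.
Qed.

Lemma toR_det_eq0 (M : 'M[int]_4) : \det (toR R M) = 0 -> \det M = 0.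
Proof. by rewrite det_map_mx => /eqP; rewrite intr_eq0 => /eqP. Qed.

Variables (l : 'I_4 -> {vspace 'cV[R]_4}) (A : 'M[int]_4) (a : 'I_4 -> R).
Hypothesis irrA : irreducible_poly (char_poly (intq A)).
Hypothesis eigA : eigenvalues A a.
Hypothesis lE : forall i, l i = passmx.leigenspace (linfun (mulmx (toR R A))) (a i).
Variables (v : 'cV[R]_4) (G : 'M[int]_4) (sg : 'S_4).
Hypotheses (vl : v \in l ord0) (v0 : v != 0).
Hypotheses (Gu : G \in unitmx) (Gl : permutes_lines l G sg).
Hypothesis cyc : porbit sg ord0 = [set: 'I_4]%SET.

Let Y k := iter k (mulmx (toR R G)) v.
Let sgk k := iter k sg ord0.

Let Yl k : Y k \in l (sgk k).
Proof. by elim: k => // k IH; apply: (permutes_lines_mem Gl). Qed.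

Let Y0 k : Y k != 0.
Proof.
elim: k => // k; apply: contra_neq => GY.
by rewrite -[Y k](mulKmx (toR_unitmx R Gu)) [_ *m Y k]GY mulmx0.
Qed.

Let sg4 : #|porbit sg ord0| = 4%N.
Proof. by rewrite cyc cardsT card_ord. Qed.

Let sgk4 : sgk 4%N = ord0.
Proof. by have := iter_porbit sg ord0; rewrite {1}sg4. Qed.

Let sgk_inj : injective (fun i : 'I_4 => sgk i).
Proof.
have := uniq_traject_porbit sg ord0; rewrite sg4 => U i j ij.
apply: val_inj; apply/eqP.
rewrite -(nth_uniq ord0 _ _ U) ?size_traject ?ltn_ord //.
by rewrite !nth_traject ?ltn_ord // [iter _ _ _]ij.
Qed.

Let AY k : toR R A *m Y k = a (sgk k) *: Y k.
Proof. by apply/eqP; rewrite -(mem_line lE). Qed.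

Let P : 'M[R]_4 := \matrix_(i, j) Y j i 0.

Let colPY (j : 'I_4) : col j P = Y j.
Proof. by apply/colP => i; rewrite !mxE. Qed.

Let Pu : P \in unitmx.
Proof.
apply: (@eigenvectors_unitmx _ _ (toR R A) _ (fun i : 'I_4 => a (sgk i))) => [i j|j|j].
- by move/(eigenvalues_inj irrA eigA)/sgk_inj.
- by rewrite colPY AY.
- by rewrite colPY Y0.
Qed.

(** The matrix of [G] in the basis [v, G v, G^2 v, G^3 v] when [G^4 v = c v]. *)
Definition cycle_mx (c : R) : 'M[R]_4 :=
  \matrix_(i, j) nth 0 (nth [::] [:: [:: 0; 0; 0; c]; [:: 1; 0; 0; 0];
    [:: 0; 1; 0; 0]; [:: 0; 0; 1; 0]] i) j.

Let Y4 : exists c, Y 4%N = c *: v.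
Proof.
have := Yl 4%N; rewrite sgk4 (line_vline irrA lE vl v0).
by move/vlineP.
Qed.

Let GP c : Y 4%N = c *: v -> toR R G *m P = P *m cycle_mx c.
Proof.
move=> Y4c; apply/matrixP => i j.
transitivity (Y j.+1 i 0).
  rewrite -[Y j.+1]/(toR R G *m Y j) [LHS]mxE [RHS]mxE.
  by apply: eq_bigr => k _; rewrite [P _ _]mxE.
have PE k : P i k = Y k i 0 by rewrite mxE.
rewrite [RHS]mxE [RHS]sum4 !PE.
case: j => [[|[|[|[|?]]]] ?] //; rewrite ![cycle_mx c _ _]mxE /=
  ?mulr0 ?mulr1 ?add0r ?addr0 //.
by rewrite -[LHS]/(Y 4%N i 0) Y4c mxE mulrC.
Qed.

(** A vector fixed by the cycle matrix has four equal coordinates, and the corner entry then forces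
    [c = 1]. *)
Lemma fixed_cycle (x : 'cV[R]_4) : x != 0 -> toR R G *m x = x -> Y 4%N = v.
Proof.
move=> x0 Gx; have [c Y4c] := Y4.
have [t xE] : exists t, x = P *m t by exists (invmx P *m x); rewrite mulKVmx.
have t0 : t != 0 by apply: contra_neq x0; rewrite xE => ->; rewrite mulmx0.
have Ct : cycle_mx c *m t = t.
  by apply: (can_inj (mulKmx Pu)); rewrite mulmxA -(GP Y4c) -mulmxA -xE.
have E i : (cycle_mx c *m t) i 0 = t i 0 by rewrite Ct.
have := (E 0, E 1, E 2%:R, E 3%:R).
rewrite !mxE !sum4 !mxE /= !(mul0r, mul1r, add0r, addr0) => -[[[E0 E1] E2] E3].
have t00 : t 0 0 != 0.
  apply: contra_neq t0 => t00; apply/colP => i; rewrite [RHS]mxE.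
  have i4 : [\/ i = 0, i = 1, i = 2%:R | i = 3%:R].
    case: i => [[|[|[|[|?]]]] ?] //; [apply: Or41|apply: Or42|apply: Or43|apply: Or44];
    exact: val_inj.
  by case: i4 => ->; rewrite -?E3 -?E2 -?E1.
have c1 : c = 1 by apply: (mulIf t00); rewrite mul1r -[RHS]E0 -E3 -E2 -E1.
by rewrite -[LHS]/(Y 4%N) Y4c c1 scale1r.
Qed.

(** The cyclic permutation matrix fixes [(1, 1, 1, 1)], negates [(1, -1, 1, -1)], and has zero
    diagonal, as has its square. *)
Lemma cycle_spectrum : Y 4%N = v -> [/\ \det (G - 1%:M) = 0, \det (G + 1%:M) = 0,
  \tr G = 0 & \tr (G *m G) = 0].
Proof.
move=> Y41; have E : toR R G *m P = P *m cycle_mx 1 by apply: GP; rewrite scale1r.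
have Pe (t : 'cV[R]_4) (e : R) : t != 0 -> cycle_mx 1 *m t = e *: t ->
    \det (toR R G - e%:M) = 0.
  move=> t0 Ct; apply: (@det_eq0_kernel _ _ _ (P *m t)).
    by apply: contra_neq t0 => Pt; rewrite -(mulKmx Pu t) Pt mulmx0.
  by rewrite mulmxBl mulmxA E -mulmxA Ct mul_scalar_mx -scalemxAr subrr.
have GE : toR R G = P *m cycle_mx 1 *m invmx P by rewrite -E mulmxK.
have trR (M : 'M[int]_4) : \tr (toR R M) = 0 -> \tr M = 0.
  by rewrite trace_map_mx => /eqP; rewrite intr_eq0 => /eqP.
split.
- apply: toR_det_eq0; rewrite /toR map_mxB map_mx1.
  apply: (Pe (const_mx 1)).
    by apply/eqP => /colP/(_ 0); rewrite !mxE => /eqP; rewrite oner_eq0.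
  apply/colP; case=> [[|[|[|[|?]]]] ?] //; rewrite !mxE ?sum4 ?mxE /=; ring.
- apply: toR_det_eq0; rewrite /toR map_mxD map_mx1.
  have := Pe (\col_i (-1) ^+ i) (-1); rewrite raddfN opprK; apply.
    by apply/eqP => /colP/(_ 0); rewrite !mxE expr0 => /eqP; rewrite oner_eq0.
  apply/colP; case=> [[|[|[|[|?]]]] ?] //; rewrite !mxE ?sum4 ?mxE /=; ring.
- apply: trR; rewrite GE mxtrace_mulC mulKmx // /mxtrace sum4 !mxE /=; ring.
- apply: trR; rewrite toRM GE -!mulmxA mulKmx // mxtrace_mulC -!mulmxA.
  rewrite mulVmx // mulmx1 /mxtrace sum4 !mxE !sum4 !mxE /=; ring.
Qed.

(** Dividing all [V G^k v] by the first entry [mu] of [V v] makes every first entry 1, because the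
    first row of [N] is [(1, 0, 0, 0)]. *)
Lemma order4_coordinates N V : Y 4%N = v -> order4_form N -> V \in unitmx ->
  V *m G = N *m V ->
  exists mu, exists B : 'M[int]_4, exists b : nat -> R, exists y : nat -> 'cV[R]_4,
  [/\ [/\ mu != 0, toR R V *m v = mu *: y 0%N & irreducible_poly (char_poly (intq B))],
      forall k, eigenvector1 (intq B) (b k) (y k),
      forall k, y k.+1 = toR R N *m y k, forall k, y (k + 4)%N = y k &
      injective (fun i : 'I_4 => b i)].
Proof.
move=> Y41 N4 Vu VG.
have [Vi [VVi ViV]] : exists Vi, V *m Vi = 1%:M /\ Vi *m V = 1%:M.
  by exists (invmx V); rewrite mulmxV // mulVmx.
have ViVR : toR R Vi *m toR R V = 1%:M by rewrite -toRM ViV toR1.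
pose B := V *m A *m Vi.
have irrB : irreducible_poly (char_poly (intq B)).
  rewrite (@char_poly_similar _ _ _ (intq V) (intq A)) //.
    by have := congr1 intq VVi; rewrite map_mxM map_mx1 => /mulmx1_unit[].
  by rewrite -!map_mxM /B -[_ *m Vi *m V]mulmxA ViV mulmx1.
have BV k : toR R B *m (toR R V *m Y k) = a (sgk k) *: (toR R V *m Y k).
  by rewrite /B !toRM -!mulmxA [toR R Vi *m _]mulmxA ViVR mul1mx AY scalemxAr.
pose mu := (toR R V *m v) 0 0.
have mu0 : mu != 0.
  have -> : mu = rowval (delta_mx 0 0) (toR R V *m v).
    by rewrite /rowval map_delta_mx -rowE mxE.
  apply: (eigenvector_entry_neq0 irrB (a := a (sgk 0%N))).
  - by rewrite ratmx_intq; exact: (BV 0%N).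
  - apply: contra_neq v0 => Vv.
    by rewrite -(mulKmx (toR_unitmx R Vu) v) Vv mulmx0.
  - by apply/eqP => /rowP/(_ 0); rewrite !mxE eqxx => /eqP; rewrite oner_eq0.
pose y k := mu^-1 *: (toR R V *m Y k).
have yS k : y k.+1 = toR R N *m y k.
  rewrite /y -scalemxAr; congr (_ *: _).
  by rewrite [RHS]mulmxA -toRM -VG toRM -mulmxA.
have N0 (z : 'cV[R]_4) : (toR R N *m z) 0 0 = z 0 0.
  by case: N4; rewrite mxE sum4 !mxE /= ?mul0r ?mul1r ?addr0.
have y1 k : y k 0 0 = 1.
  elim: k => [|k IH]; last by rewrite yS N0.
  by rewrite mxE mulVf.
exists mu, B, (fun k => a (sgk k)), y; split=> //.
- split=> //; by rewrite /y scalerA mulfV // scale1r.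
- by move=> k; split=> //; rewrite ratmx_intq /y -scalemxAr BV scalerA mulrC -scalerA.
- by move=> k; rewrite /y /Y iterD -/(Y 4%N) Y41.
- by move=> i j /(eigenvalues_inj irrA eigA)/sgk_inj.
Qed.

End Forward.

(** * Equivalence with the seven cases *)

Section Main.
Variable R : realType.
Local Notation ratmx := (map_mx (ratr : rat -> R)).
Local Notation intq := (map_mx (intr : int -> rat)).

Lemma cyclic_form_unitmx T : cyclic_form T \in unitmx.
Proof.
have /mulmx1_unit[] // : cyclic_form T *m mx4 [:: [:: 1; 0; 0; 0]; [:: T; -1; -1; -1];
    [:: 0; 1; 0; 0]; [:: 0; 0; 1; 0]] = 1%:M.
rewrite mx4_1; mx4_ring.
Qed.

Lemma split_form_unitmx d c : split_form d c \in unitmx.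
Proof.
have /mulmx1_unit[] // : split_form d c *m mx4 [:: [:: 1; 0; 0; 0];
    [:: 2 * c + d; 0; -1; -2]; [:: 0; 1; 0; 0]; [:: c + d; 0; 0; -1]] = 1%:M.
rewrite mx4_1; mx4_ring.
Qed.

(** Groups the cases according to the two families [cyclic_form T] and [split_form d c]. *)
Lemma seven_casesP (v : 'cV[R]_4) w w1 w2 w3 : seven_cases v w w1 w2 w3 ->
  (exists2 T : int, sim v (vec4 1 w w1 w2) & w + w1 + w2 + w3 = T%:~R) \/
  (exists d c : int, sim v (vec4 1 w w1 ((w + w2 + d%:~R) / 2)) /\
     w + w1 + w2 + w3 = 2 * c%:~R).
Proof.
move=> [|[|[|[|[|[|]]]]]] [vW Tr].
- by left; exists 0.
- by left; exists 1.
- by left; exists 2.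
- by right; exists 0, 0; rewrite addr0 mulr0.
- by right; exists 0, 1; rewrite addr0 mulr1.
- by right; exists 1, 0; rewrite mulr0.
- by right; exists 1, 1; rewrite mulr1.
Qed.

Lemma conjugates4_uniq (w w1 w2 w3 : R) : conjugates4 w w1 w2 w3 ->
  uniq [:: w; w1; w2; w3].
Proof.
move=> [p irrp pE].
have := @irreducible_roots_uniq R p _ [:: w; w1; w2; w3] id irrp.
by rewrite map_id; apply; rewrite pE !big_cons big_nil mulr1 !mulrA.
Qed.

Variables (l : 'I_4 -> {vspace 'cV[R]_4}) (A : 'M[int]_4) (a : 'I_4 -> R).
Hypothesis irrA : irreducible_poly (char_poly (intq A)).
Hypothesis eigA : eigenvalues A a.
Hypothesis lE : forall i, l i = passmx.leigenspace (linfun (mulmx (toR R A))) (a i).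
Variable v : 'cV[R]_4.
Hypotheses (vl : v \in l ord0) (v1 : v 0 0 = 1).

Let eigv : eigenvector1 (intq A) (a ord0) v.
Proof. by split=> //; rewrite ratmx_intq; apply/eqP; rewrite -(mem_line lE). Qed.

Let v0 : v != 0.
Proof. exact: eigenvector1_neq0 eigv. Qed.

Lemma proper_cyclic_symmetry_cases G : proper_cyclic_symmetry l G ->
  exists w w1 w2 w3 : R, [/\ conjugates4 w w1 w2 w3, cyclically_ordered w w1 w2 w3 &
    seven_cases v w w1 w2 w3].
Proof.
move=> [[[Gu _] [sg Gl cyc]] [S [u [ul _ ->]] [x [clx _] Gx]]].
have x0 : x != 0.
  apply: contra_notN (@klein_polyhedron_closure0 R u _) => [/eqP <- //|].
  exact: lines_basis irrA eigA lE _ ul.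
have Y4 := fixed_cycle irrA eigA lE vl v0 Gu Gl cyc x0 Gx.
have [d1 d2 t1 t2] := cycle_spectrum irrA eigA lE vl v0 Gu Gl cyc Y4.
have [N HN [V Vu VG]] := order4_classification d1 d2 t1 t2.
have [mu [B [b [y [[mu0 Vv irrB] eigB yS y4 injb]]]]] :=
  order4_coordinates irrA eigA lE vl v0 Gl cyc Y4 HN Vu VG.
have yS' k : y k.+1 = ratmx (intq N) *m y k by rewrite ratmx_intq.
have y1 k : y k 0 0 = 1 := (eigB k).2.
pose e1 : 'rV[rat]_4 := delta_mx 0 1.
pose w k := rowval e1 (y k).
have wE k : w k = y k 1 0.
  by rewrite /w /rowval map_delta_mx -rowE mxE.
have yE k i : y k.+1 i 0 = \sum_j (N i j)%:~R * y k j 0.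
  by rewrite yS mxE; apply: eq_bigr => j _; rewrite mxE.
(* Rational independence of the entries of [y 0], which separates [w] from its conjugates below. *)
have indep (c0 c1 c2 c3 : int) : c1 != 0 ->
    c0%:~R + c1%:~R * y 0%N 1 0 + c2%:~R * y 0%N 2%:R 0 + c3%:~R * y 0%N 3%:R 0 != 0.
  move=> c10; pose r : 'rV[int]_4 := \row_j nth 0 [:: c0; c1; c2; c3] j.
  have -> : c0%:~R + c1%:~R * y 0%N 1 0 + c2%:~R * y 0%N 2%:R 0 +
      c3%:~R * y 0%N 3%:R 0 = rowval (intq r) (y 0%N).
    by rewrite /rowval ratmx_intq mxE sum4 !mxE /= y1 mulr1.
  apply: eigenvector_entry_neq0 irrB (eigB 0%N).1 (eigenvector1_neq0 (eigB 0%N)) _.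
  by apply/eqP => /rowP/(_ 1); rewrite !mxE /= => /eqP; rewrite intr_eq0 (negPf c10).
(* The second row of each of the seven matrices is [(0, 0, 1, 0)]. *)
have wS k : w k.+1 = y k 2%:R 0.
  by rewrite wE yE; case: HN; rewrite sum4 !mxE /= !(mul0r, mul1r, add0r, addr0).
have w01 : w 0%N != w 1%N.
  by apply: contra_neq (indep 0 1 (-1) 0 isT); rewrite wE wS => ->; ring.
exists (w 0%N), (w 1%N), (w 2%N), (w 3%N).
have ordered := cyclically_ordered_rowval irrB eigB yS' y4 e1.
have conj := conjugates4_rowval irrB eigB yS' y4 injb w01.
have simW z : y 0%N 3%:R 0 = z -> sim v (vec4 1 (w 0%N) (w 1%N) z).
  move=> yz; exists V, mu; split=> //; rewrite Vv; congr (_ *: _); apply/colP.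
  by case=> [[|[|[|[|?]]]] ?] //; rewrite mxE /= -?yz -?(y1 0%N) ?wS ?wE;
    congr (y _ _ _); apply: val_inj.
have [[T [NE TE]]|[d [c [NE dcE]]]] :
    (exists T, N = cyclic_form T /\ (T = 0 \/ T = 1 \/ T = 2)) \/
    (exists d c, N = split_form d c /\
      ((d = 0 /\ (c = 0 \/ c = 1)) \/ (d = 1 /\ (c = 0 \/ c = 1)))).
- case: HN; [left|left|left|right|right|right|right].
  + by exists 0; split=> //; left.
  + by exists 1; split=> //; right; left.
  + by exists 2; split=> //; right; right.
  + by exists 0, 0; split=> //; left; split=> //; left.
  + by exists 0, 1; split=> //; left; split=> //; right.
  + by exists 1, 0; split=> //; right; split=> //; left.
  + by exists 1, 1; split=> //; right; split=> //; right.
- have y2E k : y k.+1 2%:R 0 = y k 3%:R 0.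
    by rewrite yE NE sum4 !mxE /= !(mul0r, mul1r, add0r, addr0).
  have y3E k : y k.+1 3%:R 0 = T%:~R - y k 1 0 - y k 2%:R 0 - y k 3%:R 0.
    by rewrite yE NE sum4 !mxE /= y1; ring.
  have w02 : w 0%N != w 2%N.
    by apply: contra_neq (indep 0 1 0 (-1) isT); rewrite wE wS y2E => ->; ring.
  have Tr : w 0%N + w 1%N + w 2%N + w 3%N = T%:~R.
    by rewrite !wS wE !y2E y3E; ring.
  split=> //; first exact: conj.
  have S2 : sim v (vec4 1 (w 0%N) (w 1%N) (w 2%N)) by apply: simW; rewrite wS y2E.
  rewrite /seven_cases Tr.
  by case: TE => [->|[->|->]]; [left | right; left | right; right; left].
- have y2E k : y k.+1 2%:R 0 = 2 * y k 3%:R 0 - y k 1 0 - d%:~R.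
    by rewrite yE NE sum4 !mxE /= y1; ring.
  have y3E k : y k.+1 3%:R 0 = c%:~R + d%:~R - y k 3%:R 0.
    by rewrite yE NE sum4 !mxE /= y1; ring.
  (* An equality would read [d + 2 w - 2 z = 0], where [z] is the last entry of [y 0]. *)
  have w02 : w 0%N != w 2%N.
    apply: contra_neq (indep d 2 0 (-2) isT); rewrite wE wS y2E => E.
    by rewrite -[RHS](subrr (y 0%N 1 0)) [X in _ = _ - X]E; ring.
  have Tr : w 0%N + w 1%N + w 2%N + w 3%N = 2 * c%:~R.
    have w2E k : w k.+2 = 2 * y k 3%:R 0 - w k - d%:~R by rewrite wS y2E wE.
    by rewrite !w2E y3E; ring.
  split=> //; first exact: conj.
  have S2 : sim v (vec4 1 (w 0%N) (w 1%N) ((w 0%N + w 2%N + d%:~R) / 2)).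
    by apply: simW; rewrite wS wE y2E; field.
  rewrite /seven_cases Tr.
  case: dcE S2 => -[-> cE]; rewrite ?addr0 => S2; do 3 right.
    by case: cE => ->; [left | right; left]; rewrite ?mulr0 ?mulr1.
  by do 2 right; case: cE => ->; [left | right]; rewrite ?mulr0 ?mulr1.
Qed.

Lemma cases_proper_cyclic_symmetry (w w1 w2 w3 : R) :
  conjugates4 w w1 w2 w3 -> cyclically_ordered w w1 w2 w3 ->
  seven_cases v w w1 w2 w3 -> exists G, proper_cyclic_symmetry l G.
Proof.
move=> /conjugates4_uniq wU.
rewrite /cyclically_ordered; set K := Qadjoin _.
move=> [s [sK s1 sD sM [s01 s12 s23 s30]]] cases.
have divK : GRing.divring_closed [pred x | `[< K x >]] by apply: Qadjoin_divring.
have KP x : x \in [pred x | `[< K x >]] <-> K x.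
  by split=> [/asboolP|Kx] //; apply/asboolP.
have KD x y : K x -> K y -> K (x + y).
  by move=> /KP Kx /KP Ky; apply/KP/(divringD divK).
have KM x y : K x -> K y -> K (x * y).
  by move=> /KP Kx /KP Ky; apply/KP/(divringM divK).
have Kint (z : int) : K z%:~R.
  by rewrite -(ratr_int R); apply/KP/divring_closed_ratr.
have Khalf : K 2^-1.
  by apply/KP; rewrite -[2^-1]mul1r; case: divK => K1 _; apply=> //; apply/KP/(Kint 2).
pose c (k : 'I_4) := nth 0 [:: w; w1; w2; w3] k.
have cK k : K (c k) by apply: mem_Qadjoin; rewrite mem_nth.
have sc k : s (c k) = c (k + 1) by case: k => [[|[|[|[|?]]]] ?].
have injc : injective c.
  by move=> i j /eqP; rewrite nth_uniq // => /eqP/val_inj.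
have s0 : s 0 = 0.
  by apply: (@addrI _ (s 0)); rewrite -sD ?addr0 //; apply: (Kint 0).
have s2 : s 2 = 2 by rewrite -[2]/(1 + 1) sD ?s1 //; apply: (Kint 1).
have shalf x : K x -> s (x / 2) = s x / 2.
  move=> Kx; apply: (canRL (mulfK _)); first by rewrite pnatr_eq0.
  rewrite -{2}s2 -sM ?divfK ?pnatr_eq0 //; first exact: KM.
  exact: (Kint 2).
pose W u k := vec4 1 (c k) (c (k + 1)) (u k).
(* [u k] is the last entry of the [k]-th conjugate vector, and [m] its sum over the cycle. *)
have core N u X mu T m : N \in unitmx -> X \in unitmx -> mu != 0 ->
    toR R X *m v = mu *: W u 0 -> (forall k, K (u k)) ->
    (forall k, s (u k) = u (k + 1)) ->
    (forall k, toR R N *m W u k = W u (k + 1)) ->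
    \sum_k c k = T%:~R -> \sum_k u k = m%:~R ->
    exists G, proper_cyclic_symmetry l G.
  move=> Nu Xu mu0 Xv uK su NW sumc sumu.
  apply: (@cyclic_proper_symmetry _ l A a irrA eigA lE X mu v N (W u) K s) => //.
  - by move=> k; rewrite mxE.
  - by move=> i j /colP/(_ 1); rewrite !mxE /=; apply: injc.
  (* The sum of the conjugate vectors: the entry 1 sums to 4, [w] and its image both to [T], the
     last entry to [m]. *)
  - exists (\col_i nth 0 [:: 4; T; T; m] i) => //; apply/colP => i.
    rewrite summxE !mxE; case: i => [[|[|[|[|?]]]] ?] //=;
      under [RHS]eq_bigr do rewrite mxE /=.
    + by rewrite sumr_const card_ord.
    + by rewrite sumc.
    + by rewrite -sumc (reindex_inj (@addIr _ (1 : 'I_4))).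
    + by rewrite sumu.
  - move=> k i; rewrite mxE; case: i => [[|[|[|[|?]]]] ?] //=.
    exact: (Kint 1).
  - by move=> k i; rewrite !mxE; case: i => [[|[|[|[|?]]]] ?] /=.
have sumcE : \sum_k c k = w + w1 + w2 + w3 by rewrite sum4.
have [[T [X [mu [Xu mu0 Xv]]] Tr]|[d [e [[X [mu [Xu mu0 Xv]]] Tr]]]] :=
  seven_casesP cases.
- apply: (core (cyclic_form T) (fun k => c (k + 2%:R)) X mu T T) => //.
  + exact: cyclic_form_unitmx.
  + by move=> k; rewrite sc addrAC.
  + move=> k; apply/colP => i; rewrite mxE sum4 !mxE.
    case: i => [[|[|[|[|?]]]] ?] //=; rewrite -?Tr;
      case: k => [[|[|[|[|?]]]] ?] //; rewrite /c /=; ring.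
  + by rewrite sumcE.
  + by rewrite sum4 /c /= -Tr; ring.
- pose u k := (c k + c (k + 2%:R) + d%:~R) / 2.
  have sd : s d%:~R = d%:~R by apply: (additive_fixes_int Kint).
  (* Summing [(w + w'' + d) / 2] over the cycle gives the trace [2 e] plus [2 d]. *)
  apply: (core (split_form d e) u X mu (2 * e) (2 * e + 2 * d)) => //.
  + exact: split_form_unitmx.
  + by move=> k; apply: KM => //; do 2!apply: (KD) => //.
  + move=> k; rewrite shalf; last by do 2!apply: (KD) => //.
    rewrite !sD // ?sc ?sd //; last exact: KD.
    by rewrite /u [k + 1 + _]addrAC.
  + have eE : e%:~R = (w + w1 + w2 + w3) / 2 by rewrite Tr; field.
    move=> k; apply/colP => i; rewrite mxE sum4 !mxE.
    case: i => [[|[|[|[|?]]]] ?] //=; rewrite ?intrD ?eE;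
      case: k => [[|[|[|[|?]]]] ?] //; rewrite /u /c /=; by field.
  + by rewrite sumcE Tr intrM.
  + rewrite /u sum4 /c /=.
    have -> : (2 * e + 2 * d)%:~R = (w + w1 + w2 + w3) + 2 * d%:~R :> R.
      by rewrite Tr intrD !intrM.
    by field.
Qed.

Lemma cases_normal (w w1 w2 w3 : R) : conjugates4 w w1 w2 w3 ->
  seven_cases v w w1 w2 w3 -> normal_over_Q (Qspan v).
Proof.
move=> conj cases; apply: (normal_Qspan irrA eigv conj).
set V := Qspan v.
have divV : GRing.divring_closed [pred x | `[< V x >]].
  exact: (Qspan_divring irrA eigv).
have VP x : x \in [pred x | `[< V x >]] <-> V x.
  by split=> [/asboolP|Vx] //; apply/asboolP.
have VD x y : V x -> V y -> V (x + y).
  by move=> /VP Vx /VP Vy; apply/VP/(divringD divV).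
have VM x y : V x -> V y -> V (x * y).
  by move=> /VP Vx /VP Vy; apply/VP/(divringM divV).
have VB x y : V x -> V y -> V (x - y).
  by move=> /VP Vx /VP Vy; apply/VP; case: divV => _ + _; apply.
have Vdiv x y : V x -> V y -> V (x / y).
  by move=> /VP Vx /VP Vy; apply/VP; case: divV => _ _; apply.
have Vint (z : int) : V z%:~R.
  by rewrite -(ratr_int R); apply/VP/divring_closed_ratr.
(* The entries of [X v] lie in the field [V], and the first of them is [mu]; dividing by [mu] stays
   in [V]. *)
have entries z : sim v (vec4 1 w w1 z) -> [/\ V w, V w1 & V z].
  move=> [X [mu [_ mu0 Xv]]].
  have VX i : V ((toR R X *m v) i 0).
    exists (row i (intq X)); rewrite /rowval map_row ratmx_intq -row_mul.
    by rewrite [RHS]mxE.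
  have Vmu : V mu by have := VX 0; rewrite Xv !mxE /= mulr1.
  have VW i : V (vec4 1 w w1 z i 0).
    by have := Vdiv _ _ (VX i) Vmu; rewrite Xv mxE mulrC mulKf.
  by split; [have := VW 1 | have := VW 2%:R | have := VW 3%:R]; rewrite mxE.
(* The remaining conjugate is recovered from the trace. *)
have last T : V w -> V w1 -> V w2 -> w + w1 + w2 + w3 = T -> V T -> V w3.
  move=> Vw Vw1 Vw2 TE VT.
  have -> : w3 = T - (w + w1 + w2) by rewrite -TE addrC addKr.
  by apply: VB => //; do 2!apply: (VD) => //.
have all : [/\ V w, V w1, V w2 & V w3].
  have [[T simv Tr]|[d [e [simv Tr]]]] := seven_casesP cases.
    have [Vw Vw1 Vw2] := entries _ simv.
    by split=> //; apply: last Vw Vw1 Vw2 Tr (Vint T).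
  have [Vw Vw1 Vz] := entries _ simv.
  have Vw2 : V w2.
    rewrite (_ : w2 = ((w + w2 + d%:~R) / 2) * 2%:~R - w - d%:~R); last by field.
    by do 2!apply: (VB) => //; apply: VM.
  by split=> //; apply: last Vw Vw1 Vw2 Tr (VM _ _ (Vint 2) (Vint e)).
by move=> x; rewrite !inE => /or4P[]/eqP ->; case: all.
Qed.

End Main.

Theorem theorem2 (R : realType) (l : 'I_4 -> {vspace 'cV[R]_4})
    (alpha beta gamma : R)
    (hl : algebraic_CF l)
    (hl1 : l ord0 = <[vec4 1 alpha beta gamma]>%VS) :
  ((exists G : 'M[int]_4, proper_cyclic_symmetry l G) <->
   (exists w w1 w2 w3 : R,
      [/\ conjugates4 w w1 w2 w3, cyclically_ordered w w1 w2 w3 &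
          seven_cases (vec4 1 alpha beta gamma) w w1 w2 w3])) /\
  ((exists w w1 w2 w3 : R, conjugates4 w w1 w2 w3 /\
      seven_cases (vec4 1 alpha beta gamma) w w1 w2 w3) ->
   degree_over_Q (Qadjoin [:: alpha; beta; gamma]) 4 /\
   normal_over_Q (Qadjoin [:: alpha; beta; gamma])).
Proof.
have [A [a [[_ _ irrA] eigA lE]]] := hl.
set v := vec4 1 alpha beta gamma in hl1 *.
have vl : v \in l ord0 by rewrite hl1 memv_line.
have v1 : v 0 0 = 1 by rewrite mxE.
split; first split.
- by move=> [G]; apply: (proper_cyclic_symmetry_cases irrA eigA lE vl v1).
- move=> [w [w1 [w2 [w3 [conj ord cases]]]]].
  exact: (cases_proper_cyclic_symmetry irrA eigA lE vl conj ord cases).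
- move=> [w [w1 [w2 [w3 [conj cases]]]]].
  have eigv : eigenvector1 (map_mx intr A) (a ord0) v.
    by split=> //; rewrite ratmx_intq; apply/eqP; rewrite -(mem_line lE).
  have -> : Qadjoin [:: alpha; beta; gamma] = Qspan v.
    apply: (Qadjoin_Qspan irrA eigv) => [x|i].
      rewrite !inE => /or3P[]/eqP ->.
      + by have := Qspan_entry v 1; rewrite mxE.
      + by have := Qspan_entry v 2%:R; rewrite mxE.
      + by have := Qspan_entry v 3%:R; rewrite mxE.
    by rewrite mxE; case: i => [[|[|[|[|?]]]] ?] //=; rewrite !inE eqxx ?orbT.
  split; first exact: (degree_Qspan irrA eigv).
  exact: (cases_normal irrA lE vl v1 conj cases).
Qed.
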